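(* Let $\mathcal O\in\mathrm{Op}^{\mathrm{un}}$ be a unital $\infty$-operad and for $k\ge1$ write $\mathrm{L}_k\mathcal O:=\mathrm{L}_k((\mathcal O)^k)$, with the canonical filtration $\mathrm{L}_1\mathcal O\to\mathrm{L}_2\mathcal O\to\cdots\to\mathrm{L}_k\mathcal O\to\cdots\to\mathcal O$. Then the canonical map $$\operatorname*{colim}_{k\in\mathbb N_{\ge1}}\mathrm{L}_k\mathcal O\to\mathcal O$$ is an equivalence.
   Context: **Trees.** A (dendroidal) tree $(T,L)$, often written $T$, is a finite poset $T$ with a minimal element (a least element, called the root) such that $\{y\le x\}$ is linearly ordered for every $x\in T$, together with a subset $L$ of the maximal elements of $T$ (the leaves). Elements of $T$ are called edges. For an edge $e$, $v(e)$ is the set of minimal elements of $T_{>e}$, and $|v(e)|$ is the valence of $e$. The edge $\eta$ is $(\{r\},\{r\})$; the $n$-corolla $C_n$ ($n\ge1$) is $\{0,1,\dots,n\}$ with $0$ least, $1,\dots,n$ pairwise incomparable and $L=\{1,\dots,n\}$; $C_0=(\{0\},\varnothing)$. **Category $\Omega$.** Objects are trees; $\mathrm{Hom}_\Omega(T,T')$ is the set of operad maps $\mathrm{Free}(T)\to\mathrm{Free}(T')$, where $\mathrm{Free}(T)$ is the coloured symmetric operad in sets with colours the edges of $T$, freely generated by one operation $v(e)\to e$ for each non-leaf edge $e$. **Closed trees.** A tree is closed if $L=\varnothing$; $\Omega^c\subset\Omega$ is the full subcategory of closed trees. (Explicitly: objects are finite rooted trees and morphisms are order-preserving maps that preserve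 independence, i.e. send incomparable pairs to incomparable pairs.) The inclusion $\Omega^c\hookrightarrow \Omega$ has left adjoint $(T,L)^c=(T,\varnothing)$. A tree is $k$-dendroidal if all its edges have valence $\le k$ (no condition if $k=\infty$); $\Omega^c_{\le k}\subset\Omega^c$ is the full subcategory of closed $k$-dendroidal trees, $\Omega^c_{\le\infty}=\Omega^c$. **Segal presheaves.** $\mathcal S$ is the $\infty$-category of spaces and $\mathcal P(\mathcal C)=\mathrm{Fun}(\mathcal C^{\mathrm{op}},\mathcal S)$. A morphism $f\colon T\to T'$ is a subtree inclusion if it is injective on edges and whenever $f(e_0)\le e'\le f(e_2)$ with $e'\in T'$, $e'$ lies in the image of $f$. For a tree $T$, $(\Omega^{\mathrm{el}})_{/T}\subset\Omega_{/T}$ is the full subcategory of subtree inclusions $f\colon X\to T$ with $X=\eta$ or $X=C_n$ for some $n$, where, if $X=C_n$ has root $x$, the edge $f(x)$ must also have valence $n$. A presheaf $\mathcal F$ on $\Omega^c_{\le k}$ is Segal if for every closed $k$-dendroidal $T$ the canonical map $\mathcal F(T)\to\lim_{X\in((\Omega^{\mathrm{el}})_{/T})^{\mathrm{op}}}\mathcal F(X^c)$ is an equivalence. Let $r\colon\Delta\to\Omega^c_{\le k}$ send $[n]$ to the closure of $(\{0\le1\le\dots\le n\},\{n\})$. A Segal presheaf $\mathcal F$ is complete if $r^*\mathcal F$ is a complete Segal space in the sense of Rezk. **Operads.** $\mathrm{Op}^{\mathrm{un}}_{\le k}$ is the full subcategory of $\mathcal P(\Omega^c_{\le k})$ on complete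 Segal presheaves; $\mathrm{Op}^{\mathrm{un}}=\mathrm{Op}^{\mathrm{un}}_{\le\infty}$ (equivalent to the $\infty$-category of unital $\infty$-operads). $(-)^k=i_k^*\colon\mathrm{Op}^{\mathrm{un}}\to\mathrm{Op}^{\mathrm{un}}_{\le k}$ is restriction along $i_k\colon\Omega^c_{\le k}\hookrightarrow\Omega^c$; $\mathrm{L}_k\colon\mathrm{Op}^{\mathrm{un}}_{\le k}\to\mathrm{Op}^{\mathrm{un}}$ is its fully faithful left adjoint, given by left Kan extension along $i_k$. The maps in the filtration are induced by the counits of these adjunctions. *)

(* Defs.v *)
(* Spaces are modelled by simplicial sets up to weak equivalence, and the
   oo-category P(C) of presheaves of spaces on a category C by the simplicially
   enriched category of injectively fibrant simplicial presheaves on C: every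
   presheaf of spaces is represented by such an object, equivalences are the
   objectwise weak equivalences, and [Map X P] is the mapping space from X to P
   as soon as P is injectively fibrant (every X is injectively cofibrant). *)

From HB Require Import structures.
Set Warnings "-notation-overridden,-redundant-canonical-projection".
From mathcomp Require Import all_boot all_order.
From mathcomp Require Import boolp.
From Stdlib Require Import Relation_Operators.

Set Implicit Arguments.
Unset Strict Implicit.
Unset Printing Implicit Defensive.

Import Order.Theory.

Local Obligation Tactic := idtac.

Record cat := Cat {
  ob :> Type;
  hom : ob -> ob -> Type;
  idm : forall a, hom a a;
  comp : forall a b c, hom b c -> hom a b -> hom a c;
  compm1 : forall a b (f : hom a b), comp f (idm a) = f;
  comp1m : forall a b (f : hom a b), comp (idm b) f = f;
  compA : forall a b c d (h : hom c d) (g : hom b c) (f : hom a b),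
    comp h (comp g f) = comp (comp h g) f }.

Arguments hom {C} a b : rename.
Arguments idm {C} a : rename.
Arguments comp {C a b c} g f : rename.

Declare Scope cat_scope.
Notation "g 'oc' f" := (comp g f) (at level 40, left associativity) : cat_scope.
Local Open Scope cat_scope.

Definition opc (C : cat) : cat :=
  @Cat C (fun a b => hom b a) idm (fun a b c g f => f oc g)
    (fun a b f => comp1m f) (fun a b f => compm1 f)
    (fun a b c d h g f => esym (compA f g h)).

Record functor (C D : cat) := Functor {
  fob :> C -> D;
  fmap : forall a b, hom a b -> hom (fob a) (fob b);
  fmap1 : forall a, fmap (idm a) = idm (fob a);
  fmapM : forall a b c (g : hom b c) (f : hom a b),
    fmap (g oc f) = fmap g oc fmap f }.

Arguments fmap {C D} f {a b} g : rename.

Program Definition fcomp (C D E : cat) (G : functor D E) (F : functor C D) :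
    functor C E :=
  @Functor C E (fun a => G (F a)) (fun a b f => fmap G (fmap F f)) _ _.
Next Obligation. by move=> *; rewrite /= !fmap1. Qed.
Next Obligation. by move=> *; rewrite /= !fmapM. Qed.

Definition opf (C D : cat) (F : functor C D) : functor (opc C) (opc D) :=
  @Functor (opc C) (opc D) F (fun a b f => fmap F f) (fmap1 F)
    (fun a b c g f => fmapM F f g).

Lemma eq_functor (C D : cat) (o : C -> D) m m' i i' c c' : m = m' ->
  @Functor C D o m i c = @Functor C D o m' i' c'.
Proof. by move=> E; case: _ / E i' c' => i' c'; f_equal. Qed.

Set Primitive Projections.
Record fullsub_ob (C : cat) (P : C -> Prop) :=
  FullSub { fs_ob : C; fs_prop : P fs_ob }.
Unset Primitive Projections.

Definition fullsub (C : cat) (P : C -> Prop) : cat :=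
  @Cat (fullsub_ob P) (fun a b => hom (fs_ob a) (fs_ob b))
    (fun a => idm (fs_ob a)) (fun a b c g f => g oc f)
    (fun a b f => compm1 f) (fun a b f => comp1m f)
    (fun a b c d h g f => compA h g f).

Definition fullsub_incl (C : cat) (P : C -> Prop) : functor (fullsub P) C :=
  @Functor (fullsub P) C (fun a => fs_ob a) (fun a b f => f)
    (fun a => erefl) (fun a b c g f => erefl).

Definition fullsub_sub (C : cat) (P Q : C -> Prop) (PQ : forall x, P x -> Q x) :
    functor (fullsub P) (fullsub Q) :=
  @Functor (fullsub P) (fullsub Q)
    (fun a => FullSub (PQ (fs_ob a) (fs_prop a)))
    (fun a b f => f) (fun a => erefl) (fun a b c g f => erefl).

Definition preorder_cat (T : Type) (r : rel T) (rr : reflexive r)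
    (rt : transitive r) : cat :=
  @Cat T r (fun a => rr a) (fun a b c g f => @rt b a c f g)
    (fun _ _ _ => bool_irrelevance _ _) (fun _ _ _ => bool_irrelevance _ _)
    (fun _ _ _ _ _ _ _ => bool_irrelevance _ _).

Definition natc : cat := preorder_cat leqnn leq_trans.

Definition ordc (n : nat) : cat :=
  @preorder_cat 'I_n.+1 (fun i j => (i <= j)%N)
    (fun i => leqnn i) (fun i j k => @leq_trans i j k).

Record simp (m n : nat) := Simp {
  simp_fun :> 'I_m.+1 -> 'I_n.+1;
  simp_homo : forall i j : 'I_m.+1,
    (i <= j)%N -> (simp_fun i <= simp_fun j)%N }.

Lemma simpP m n (f g : simp m n) : f =1 g -> f = g.
Proof. by case: f g => f hf [g hg] /= /funext E; subst g; f_equal. Qed.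

Definition simp_id n : simp n n := @Simp n n id (fun i j h => h).

Definition simp_comp l m n (g : simp m n) (f : simp l m) : simp l n :=
  @Simp l n (fun i => g (f i))
    (fun i j h => simp_homo g (simp_homo f h)).

Lemma simp_compm1 m n (f : simp m n) : simp_comp f (simp_id m) = f.
Proof. exact: simpP. Qed.

Lemma simp_comp1m m n (f : simp m n) : simp_comp (simp_id n) f = f.
Proof. exact: simpP. Qed.

Lemma simp_compA k l m n (h : simp m n) (g : simp l m) (f : simp k l) :
  simp_comp h (simp_comp g f) = simp_comp (simp_comp h g) f.
Proof. exact: simpP. Qed.

Definition simp_const m n (k : 'I_n.+1) : simp m n :=
  @Simp m n (fun=> k) (fun i j h => leqnn k).

Definition delta : cat :=
  @Cat nat simp simp_id (fun a b c => @simp_comp a b c)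
    simp_compm1 simp_comp1m simp_compA.

Definition simp_functor m n (f : simp m n) : functor (ordc m) (ordc n) :=
  @Functor (ordc m) (ordc n) f (fun i j h => @simp_homo m n f i j h)
    (fun _ => bool_irrelevance _ _) (fun _ _ _ _ _ => bool_irrelevance _ _).

Record sset := SSet {
  simplex :> nat -> Type;
  act : forall m n, simp m n -> simplex n -> simplex m;
  act1 : forall n (x : simplex n), act (simp_id n) x = x;
  actM : forall l m n (f : simp l m) (g : simp m n) (x : simplex n),
    act (simp_comp g f) x = act f (act g x) }.

Arguments act {s m n} f x.

Record smap (X Y : sset) := SMap {
  smap_fun :> forall n, X n -> Y n;
  smap_act : forall m n (f : simp m n) (x : X n),
    smap_fun (act f x) = act f (smap_fun x) }.

Arguments smap_fun {X Y} s {n} x.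

Lemma smapP (X Y : sset) (f g : smap X Y) :
  (forall n (x : X n), f n x = g n x) -> f = g.
Proof.
case: f g => f hf [g hg] /= E.
have {}E : f = g by apply: functional_extensionality_dep => n; apply: funext => x.
by subst g; f_equal.
Qed.

Program Definition smap_comp (X Y Z : sset) (g : smap Y Z) (f : smap X Y) :
    smap X Z := @SMap X Z (fun n x => g n (f n x)) _.
Next Obligation. by move=> *; rewrite /= !smap_act. Qed.

Definition std (n : nat) : sset :=
  @SSet (fun m => simp m n) (fun l m f g => simp_comp g f)
    (fun m f => simp_compm1 f) (fun k l m f g h => simp_compA h g f).

Program Definition sprod (X Y : sset) : sset :=
  @SSet (fun n => (X n * Y n)%type) (fun m n f p => (act f p.1, act f p.2)) _ _.
Next Obligation. by move=> X Y n [x y] /=; rewrite !act1. Qed.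
Next Obligation. by move=> X Y l m n f g [x y] /=; rewrite !actM. Qed.

Program Definition sub_sset (X : sset) (P : forall n, X n -> Prop)
    (PA : forall m n (f : simp m n) x, P n x -> P m (act f x)) : sset :=
  @SSet (fun n => {x : X n | P n x})
    (fun m n f x => exist (P m) (act f (sval x)) (PA m n f _ (svalP x))) _ _.
Next Obligation. by move=> X P PA n [x h]; apply: eq_exist; rewrite /= act1. Qed.
Next Obligation. by move=> *; apply: eq_exist; rewrite /= actM. Qed.

(* A simplex of std n lies in the k-th horn iff it misses a vertex i <> k. *)
Definition in_horn n (k : 'I_n.+1) m (f : std n m) : Prop :=
  exists2 i : 'I_n.+1, i != k & forall j, f j != i.

Program Definition horn n (k : 'I_n.+1) : sset := @sub_sset (std n) (in_horn k) _.
Next Obligation. by move=> n k l m f g [i ik gi]; exists i => // j; apply: gi. Qed.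

Definition kan (X : sset) : Prop :=
  forall n (k : 'I_n.+2) (h : smap (horn k) X),
    exists s : smap (std n.+1) X,
      forall m (x : horn k m), s m (sval x) = h m x.

Definition const_at X n (t : 'I_2) (x : simplex X n) : sprod X (std 1) n :=
  (x, simp_const n t).

Definition homotopy (X Y : sset) (f g : smap X Y) : Prop :=
  exists H : smap (sprod X (std 1)) Y, forall n (x : X n),
    H n (const_at ord0 x) = f n x /\ H n (const_at ord_max x) = g n x.

Definition homotopic (X Y : sset) : smap X Y -> smap X Y -> Prop :=
  clos_refl_sym_trans (smap X Y) (@homotopy X Y).

(* Weak homotopy equivalence: every Kan complex K sees f as a bijection
   [Y, K] -> [X, K] of sets of homotopy classes. *)
Definition weq (X Y : sset) (f : smap X Y) : Prop :=
  forall K, kan K ->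
    (forall g : smap X K, exists h : smap Y K, homotopic (smap_comp h f) g) /\
    (forall h h' : smap Y K,
       homotopic (smap_comp h f) (smap_comp h' f) -> homotopic h h').

Program Definition nerve (J : cat) : sset :=
  @SSet (fun n => functor (ordc n) J)
    (fun m n f s => fcomp s (simp_functor f)) _ _.
Next Obligation.
move=> J n [o m i c]; apply: eq_functor.
do 3 apply: functional_extensionality_dep => ?.
by congr (m _ _); apply: bool_irrelevance.
Qed.
Next Obligation.
move=> J l m n f g [o h i c]; apply: eq_functor.
do 3 apply: functional_extensionality_dep => ?.
by congr (h _ _); apply: bool_irrelevance.
Qed.

Record diagram (J : cat) := Diagram {
  dob :> J -> sset;
  dmap : forall i j, hom i j -> smap (dob i) (dob j);
  dmap1 : forall i n (x : dob i n), dmap (idm i) n x = x;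
  dmapM : forall i j k (g : hom j k) (f : hom i j) n (x : dob i n),
    dmap (g oc f) n x = dmap g n (dmap f n x) }.

Arguments dmap {J} d {i j} f : rename.
Arguments dmap1 {J} d {i n} x : rename.
Arguments dmapM {J} d {i j k} g f {n} x : rename.

Notation spsh C := (diagram (opc C)).

Record nat_tr (J : cat) (X Y : diagram J) := NatTr {
  nt :> forall j, smap (X j) (Y j);
  nt_nat : forall i j (f : hom i j) n (x : X i n),
    nt j n (dmap X f n x) = dmap Y f n (nt i n x) }.

Lemma nat_trP (J : cat) (X Y : diagram J) (f g : nat_tr X Y) :
  (forall j n (x : X j n), f j n x = g j n x) -> f = g.
Proof.
case: f g => f hf [g hg] /= E.
have {}E : f = g by apply: functional_extensionality_dep => j; apply: smapP.
by subst g; f_equal.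
Qed.

Program Definition nat_comp (J : cat) (X Y Z : diagram J)
    (g : nat_tr Y Z) (f : nat_tr X Y) : nat_tr X Z :=
  @NatTr J X Z (fun j => smap_comp (g j) (f j)) _.
Next Obligation. by move=> *; rewrite /= !nt_nat. Qed.

Definition pull (I J : cat) (u : functor I J) (X : diagram J) : diagram I.
Proof.
apply: (@Diagram I (fun i => X (u i)) (fun i j f => dmap X (fmap u f))).
- by move=> i n x; rewrite fmap1 dmap1.
- by move=> i j k g f n x; rewrite fmapM dmapM.
Defined.

Program Definition dprod (J : cat) (X : diagram J) (K : sset) : diagram J :=
  @Diagram J (fun j => sprod (X j) K)
    (fun i j f => @SMap _ _ (fun n p => (dmap X f n p.1, p.2)) _) _ _.
Next Obligation. by move=> *; rewrite /= smap_act. Qed.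
Next Obligation. by move=> J X K i n [x t]; rewrite /= dmap1. Qed.
Next Obligation. by move=> *; rewrite /= dmapM. Qed.

(* The simplicial set of maps X -> Y; its m-simplices are the X x D^m -> Y. *)
Program Definition Map (J : cat) (X Y : diagram J) : sset :=
  @SSet (fun m => nat_tr (dprod X (std m)) Y)
    (fun l m t f => @NatTr J _ Y
       (fun j => @SMap _ _ (fun n p => f j n (p.1, simp_comp t p.2)) _) _) _ _.
Next Obligation.
move=> J X Y l m t f j a b s [x u] /=; rewrite -smap_act /=.
by congr (f j _ (_, _)); apply: simpP.
Qed.
Next Obligation. 
move=> J X Y l m t f i j g n [x u].
exact: (nt_nat f g (x, simp_comp t u)).
 Qed.
Next Obligation.
move=> J X Y n f; apply: nat_trP => j m [x u] /=.
by congr (f j _ (_, _)); apply: simpP.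
Qed.
Next Obligation.
move=> J X Y k l m t s f; apply: nat_trP => j n [x u] /=.
by congr (f j _ (_, _)); apply: simpP.
Qed.

Program Definition Map_pre (J : cat) (X X' Y : diagram J) (f : nat_tr X X') :
    smap (Map X' Y) (Map X Y) :=
  @SMap (Map X' Y) (Map X Y) (fun m h => @NatTr J _ Y
    (fun j => @SMap _ _ (fun n p => h j n (f j n p.1, p.2)) _) _) _.
Next Obligation. by move=> *; rewrite -smap_act /= smap_act. Qed.
Next Obligation. by move=> *; rewrite -nt_nat /= nt_nat. Qed.
Next Obligation. by move=> *; apply: nat_trP. Qed.

Lemma fmap_trans (J : cat) n (s : functor (ordc n) J) (i j k : 'I_n.+1)
    (ij : (i <= j)%N) (jk : (j <= k)%N) (ik : (i <= k)%N) :
  @fmap _ _ s j k jk oc @fmap _ _ s i j ij = @fmap _ _ s i k ik.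
Proof. by rewrite -fmapM; congr fmap; apply: bool_irrelevance. Qed.

Lemma fmap_refl (J : cat) n (s : functor (ordc n) J) (i : 'I_n.+1)
    (ii : (i <= i)%N) : @fmap _ _ s i i ii = idm (s i).
Proof. by rewrite -fmap1; congr fmap; apply: bool_irrelevance. Qed.

(* A simplex of the nerve of the slice J/j: a chain of J followed by a map from
   its last vertex to j. *)
Record slice_simplex (J : cat) (j : J) (n : nat) := SliceSimplex {
  ss_chain : functor (ordc n) J;
  ss_map : hom (ss_chain ord_max) j }.

Lemma eq_slice_simplex (J : cat) (j : J) n (o : ordc n -> J) m m' i i' c c'
    (g g' : hom (o ord_max) j) : m = m' -> g = g' ->
  @SliceSimplex J j n (@Functor (ordc n) J o m i c) g =
  @SliceSimplex J j n (@Functor (ordc n) J o m' i' c') g'.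
Proof.
move=> E <-; case: _ / E i' c' => i' c'.
by rewrite (Prop_irrelevance i i') (Prop_irrelevance c c').
Qed.

Program Definition slice_nerve (J : cat) (j : J) : sset :=
  @SSet (slice_simplex j)
    (fun m n f s => @SliceSimplex J j m
       (fcomp (ss_chain s) (simp_functor f))
       (ss_map s oc @fmap _ _ (ss_chain s) (f ord_max) ord_max (leq_ord _)))
    _ _.
Next Obligation.
move=> J j n [[o m i c] g]; apply: eq_slice_simplex => /=.
  do 3 apply: functional_extensionality_dep => ?.
  by congr (m _ _); apply: bool_irrelevance.
by rewrite -[RHS]compm1; congr (_ oc _); exact: (fmap_refl (Functor i c)).
Qed.
Next Obligation.
move=> J j l m n f g [[o h i c] u]; apply: eq_slice_simplex => /=.
  do 3 apply: functional_extensionality_dep => ?.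
  by congr (h _ _); apply: bool_irrelevance.
by rewrite -compA; congr (_ oc _); apply/esym/(fmap_trans (Functor i c)).
Qed.

Program Definition slice_nerves (J : cat) : diagram J :=
  @Diagram J (@slice_nerve J)
    (fun i j f => @SMap _ _
       (fun n s => @SliceSimplex J j n (ss_chain s) (f oc ss_map s)) _) _ _.
Next Obligation. by move=> *; rewrite /= compA. Qed.
Next Obligation. by move=> J i n [s g]; rewrite /= comp1m. Qed.
Next Obligation. by move=> *; rewrite /= compA. Qed.

(* Bousfield-Kan homotopy limit. *)
Definition holim (J : cat) (D : diagram J) : sset := Map (slice_nerves J) D.

Record cone (J : cat) (Z : sset) (D : diagram J) := Cone {
  cone_map :> forall j, smap Z (D j);
  cone_nat : forall i j (f : hom i j) n (z : Z n),
    dmap D f n (cone_map i n z) = cone_map j n z }.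

Program Definition to_holim (J : cat) (Z : sset) (D : diagram J)
    (c : cone Z D) : smap Z (holim D) :=
  @SMap Z (holim D) (fun m z => @NatTr J _ D
    (fun j => @SMap _ _ (fun n p => c j n (act p.2 z)) _) _) _.
Next Obligation. by move=> *; rewrite /= actM smap_act. Qed.
Next Obligation. by move=> *; rewrite /= cone_nat. Qed.
Next Obligation. by move=> *; apply: nat_trP => j k [s u] /=; rewrite actM. Qed.

Definition objectwise_inj (J : cat) (X Y : diagram J) (f : nat_tr X Y) : Prop :=
  forall j n, injective (f j n).

Definition objectwise_weq (J : cat) (X Y : diagram J) (f : nat_tr X Y) : Prop :=
  forall j, weq (f j).

Definition inj_fibrant (J : cat) (P : diagram J) : Prop :=
  forall (X Y : diagram J) (f : nat_tr X Y),
    objectwise_inj f -> objectwise_weq f ->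
    forall g : nat_tr X P, exists h : nat_tr Y P, nat_comp h f = g.

(* A J-indexed diagram of presheaves on C, and a cocone under it. *)
Record psh_diagram (J C : cat) := PshDiagram {
  pd_ob :> J -> spsh C;
  pd_map : forall i j, hom i j -> nat_tr (pd_ob i) (pd_ob j);
  pd_map1 : forall i c n (x : pd_ob i c n), pd_map (idm i) c n x = x;
  pd_mapM : forall i j k (g : hom j k) (f : hom i j) c n (x : pd_ob i c n),
    pd_map (g oc f) c n x = pd_map g c n (pd_map f c n x) }.

Record cocone (J C : cat) (X : psh_diagram J C) (Y : spsh C) := Cocone {
  cocone_map :> forall j, nat_tr (X j) Y;
  cocone_nat : forall i j (f : hom i j) c n (x : X i c n),
    cocone_map j c n (pd_map X f c n x) = cocone_map i c n x }.

Arguments pd_map {J C} p {i j} f : rename.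

Program Definition Map_diagram (J C : cat) (X : psh_diagram J C) (P : spsh C) :
    diagram (opc J) :=
  @Diagram (opc J) (fun j => Map (X j) P) (fun i j f => Map_pre P (pd_map X f))
    _ _.
Next Obligation.
by move=> J C X P i n h; apply: nat_trP => c m [x u] /=; rewrite pd_map1.
Qed.
Next Obligation.
by move=> J C X P i j k g f n h; apply: nat_trP => c m [x u] /=; rewrite pd_mapM.
Qed.

Program Definition Map_cone (J C : cat) (X : psh_diagram J C) (Y : spsh C)
    (c : cocone X Y) (P : spsh C) : cone (Map Y P) (Map_diagram X P) :=
  @Cone _ _ (Map_diagram X P) (fun j => Map_pre P (c j)) _.
Next Obligation.
by move=> *; apply: nat_trP => d k [x u] /=; rewrite cocone_nat.
Qed.

(* Let D define a full subcategory of P(C) (so D P should include that P is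
   injectively fibrant). The cocone c exhibits Y as the oo-categorical colimit of
   X in this subcategory, that is, the canonical map colim X -> Y there is an
   equivalence: Map(Y, P) -> lim_j Map(X_j, P) is an equivalence of spaces for
   all P in the subcategory. *)
Definition is_colimit_in (J C : cat) (D : spsh C -> Prop)
    (X : psh_diagram J C) (Y : spsh C) (c : cocone X Y) : Prop :=
  forall P : spsh C, D P -> weq (to_holim (Map_cone c P)).

Arguments is_colimit_in {J C} D X Y c.

(* Left Kan extension of F along i, by the pointwise formula: its value at T is
   the homotopy colimit of F over the opposite of the comma category of the
   T -> i S, in the form of the two-sided bar construction. An n-simplex is a
   chain S_0 -> ... -> S_n in A, a map T -> i S_0 and an n-simplex of F(S_n). *)
Record lan_simplex (A C : cat) (i : functor A C) (F : spsh A) (T : C) (n : nat) :=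
  LanSimplex {
    ls_chain : functor (ordc n) A;
    ls_map : hom T (i (ls_chain ord0));
    ls_val : F (ls_chain ord_max) n }.

Lemma eq_lan_simplex (A C : cat) (i : functor A C) (F : spsh A) (T : C) n
    (o : ordc n -> A) m m' e e' c c'
    (g g' : hom T (i (o ord0))) (x x' : F (o ord_max) n) :
  m = m' -> g = g' -> x = x' ->
  @LanSimplex A C i F T n (@Functor (ordc n) A o m e c) g x =
  @LanSimplex A C i F T n (@Functor (ordc n) A o m' e' c') g' x'.
Proof.
move=> E <- <-; case: _ / E e' c' => e' c'.
by rewrite (Prop_irrelevance e e') (Prop_irrelevance c c').
Qed.

Program Definition lan_at (A C : cat) (i : functor A C) (F : spsh A) (T : C) :
    sset :=
  @SSet (lan_simplex i F T)
    (fun m n f s => @LanSimplex A C i F T m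
       (fcomp (ls_chain s) (simp_functor f))
       (fmap i (@fmap _ _ (ls_chain s) ord0 (f ord0) (leq0n _)) oc ls_map s)
       (dmap F (@fmap _ _ (ls_chain s) (f ord_max) ord_max (leq_ord _))
          m (act f (ls_val s)))) _ _.
Next Obligation.
move=> A C i F T n [[o m e c] g x]; apply: eq_lan_simplex => /=.
- do 3 apply: functional_extensionality_dep => ?.
  by congr (m _ _); apply: bool_irrelevance.
- rewrite -[RHS]comp1m -fmap1; congr (fmap i _ oc _).
  exact: (fmap_refl (Functor e c)).
- rewrite act1 -[RHS](dmap1 F x).
  exact: (congr1 (fun h => @dmap (opc A) F _ _ h n x) (fmap_refl (Functor e c) _)).
Qed.
Next Obligation.
move=> A C i F T l m n f g [[o h e c] u x]; apply: eq_lan_simplex => /=.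
- do 3 apply: functional_extensionality_dep => ?.
  by congr (h _ _); apply: bool_irrelevance.
- rewrite compA -fmapM; congr (fmap i _ oc _).
  exact/esym/(fmap_trans (Functor e c)).
- rewrite -smap_act actM -(dmapM F).
  apply: (congr1 (fun h => @dmap (opc A) F _ _ h l (act f (act g x)))).
  exact/esym/(fmap_trans (Functor e c)).
Qed.

Program Definition lan (A C : cat) (i : functor A C) (F : spsh A) : spsh C :=
  @Diagram (opc C) (lan_at i F)
    (fun T T' f => @SMap (lan_at i F T) (lan_at i F T')
       (fun n s => @LanSimplex A C i F T' n (ls_chain s) (ls_map s oc f) (ls_val s))
       _) _ _.
Next Obligation. by move=> *; rewrite /= compA. Qed.
Next Obligation. by move=> A C i F T n [s g x]; rewrite /= compm1. Qed.
Next Obligation. by move=> *; rewrite /= compA. Qed.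

Program Definition lan_counit (A C : cat) (i : functor A C) (O : spsh C) :
    nat_tr (lan i (pull (opf i) O)) O :=
  @NatTr (opc C) _ O (fun T => @SMap _ _ (fun n s =>
    dmap O (ls_map s) n
      (dmap O (fmap i (@fmap _ _ (ls_chain s) ord0 ord_max (leq0n _))) n
         (ls_val s))) _) _.
Next Obligation.
move=> A C i O T m n f [s g x] /=; rewrite -!smap_act -!(dmapM O) /=.
apply: (congr1 (fun h => @dmap (opc C) O _ _ h m (act f x))) => /=.
rewrite !compA -2!fmapM; congr (fmap i _ oc _).
by rewrite (@fmap_trans _ _ s _ _ ord_max _ _ (leq_ord (f ord0)));
  apply: fmap_trans.

Qed.
Next Obligation. by move=> A C i O T T' f n s; apply: (dmapM O). Qed.

Record tree := Tree {
  tree_disp : Order.disp_t;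
  edge :> finPOrderType tree_disp;
  root : edge;
  root_le : forall x : edge, (root <= x)%O;
  tree_linear : forall x y z : edge,
    (y <= x)%O -> (z <= x)%O -> (y <= z)%O || (z <= y)%O;
  leaves : {set edge};
  leaves_max : forall x y : edge, x \in leaves -> (x <= y)%O -> y = x }.

(* v(e) in the usual notation; its cardinal is the valence of e. *)
Definition inputs (T : tree) (e : T) : {set T} :=
  [set x : T | (e < x)%O && [forall y : T, (e < y)%O && (y <= x)%O ==> (y == x)]].

(* free_op l e: the operad Free(T) has an operation with inputs l and output e.
   The operations are generated by inputs(e) -> e for e not a leaf. As every set of
   operations of Free(T) has at most one element, this relation is the whole
   operad, and a map of operads Free(T) -> Free(T') is a map on colours that
   preserves it. *)
Inductive free_op (T : tree) : seq T -> T -> Prop :=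
| FreeId e : free_op [:: e] e
| FreeNode e (s : T -> seq T) l :
    e \notin leaves T -> (forall c, c \in inputs e -> free_op (s c) c) ->
    perm_eq l (flatten [seq s c | c <- enum (inputs e)]) -> free_op l e.

Record omega_hom (T T' : tree) := OmegaHom {
  oh_fun :> T -> T';
  oh_op : forall l e, free_op l e -> free_op (map oh_fun l) (oh_fun e) }.

Lemma omega_homP (T T' : tree) (f g : omega_hom T T') : f =1 g -> f = g.
Proof. by case: f g => f hf [g hg] /= /funext E; subst g; f_equal. Qed.

Program Definition omega_id (T : tree) : omega_hom T T := @OmegaHom T T id _.
Next Obligation. by move=> T l e; rewrite map_id. Qed.

Program Definition omega_comp (T T' T'' : tree) (g : omega_hom T' T'')
    (f : omega_hom T T') : omega_hom T T'' :=
  @OmegaHom T T'' (fun x => g (f x)) _.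
Next Obligation.
by move=> T T' T'' g f l e /(oh_op f) /(oh_op g); rewrite -map_comp.
Qed.

Program Definition Omega : cat := @Cat tree omega_hom omega_id omega_comp _ _ _.
Next Obligation. by move=> *; apply: omega_homP. Qed.
Next Obligation. by move=> *; apply: omega_homP. Qed.
Next Obligation. by move=> *; apply: omega_homP. Qed.

Definition closed_tree (T : tree) : Prop := leaves T = set0.

Definition OmegaC : cat := @fullsub Omega closed_tree.

Program Definition closure_tree (T : tree) : tree :=
  @Tree (tree_disp T) (edge T) (root T) (@root_le T) (@tree_linear T) set0 _.
Next Obligation. by move=> T x y; rewrite in_set0. Qed.

Definition closure_ob (T : tree) : OmegaC :=
  @FullSub Omega closed_tree (closure_tree T) erefl.

Lemma inputs_gt (T : tree) (e c : T) : c \in inputs e -> (e < c)%O.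
Proof. by rewrite inE => /andP[]. Qed.

Lemma inputs_min (T : tree) (e c y : T) :
  c \in inputs e -> (e < y)%O -> (y <= c)%O -> y = c.
Proof.
by rewrite inE => /andP[_ /forallP/(_ y)] + ey yc; rewrite ey yc => /eqP.
Qed.

Lemma free_op_ge (T : tree) (l : seq T) (e x : T) :
  free_op l e -> x \in l -> (e <= x)%O.
Proof.
move=> H; elim: H x => [{}e x|{}e s {}l _ _ IH lE x].
  by rewrite inE => /eqP ->.
rewrite (perm_mem lE) => /flatten_mapP[c]; rewrite mem_enum => cv xc.
exact: le_trans (ltW (inputs_gt cv)) (IH c cv x xc).
Qed.

Lemma inputs_disjoint (T : tree) (e c c' x : T) : c \in inputs e -> c' \in inputs e ->
  (c <= x)%O -> (c' <= x)%O -> c = c'.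
Proof.
move=> cv cv' cx cx'; case/orP: (tree_linear cx cx') => h.
  exact: inputs_min cv' (inputs_gt cv) h.
by apply/esym; apply: inputs_min cv (inputs_gt cv') h.
Qed.

Lemma uniq_flatten_map (I J : eqType) (s : I -> seq J) (r : seq I) :
  uniq r -> (forall c, c \in r -> uniq (s c)) ->
  (forall c c' x, c \in r -> c' \in r -> x \in s c -> x \in s c' -> c = c') ->
  uniq (flatten [seq s c | c <- r]).
Proof.
elim: r => //= c r IH /andP[cr ur] us dis.
rewrite cat_uniq us ?mem_head //= IH //; last 2 first.
- by move=> d dr; apply: us; rewrite inE dr orbT.
- by move=> d d' x dr dr'; apply: dis; rewrite inE ?dr ?dr' orbT.
rewrite andbT; apply/hasPn => x /flatten_mapP[d dr xd]; apply/negP => /= xc.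
have E : c = d by apply: dis xc xd; rewrite inE ?eqxx // dr orbT.
by rewrite E dr in cr.
Qed.

Lemma free_op_uniq (T : tree) (l : seq T) (e : T) : free_op l e -> uniq l.
Proof.
elim=> [//|{}e s {}l _ H IH lE]; rewrite (perm_uniq lE).
apply: uniq_flatten_map => [|c|c c' x]; rewrite ?enum_uniq ?mem_enum //.
  exact: IH.
move=> cv cv' xc xc'.
apply: (inputs_disjoint cv cv').
  exact: free_op_ge (H _ cv) xc.
exact: free_op_ge (H _ cv') xc'.
Qed.

Lemma free_op_perm (T : tree) (l l' : seq T) (e : T) :
  free_op l e -> perm_eq l' l -> free_op l' e.
Proof.
case=> [{}e /perm_small_eq -> //|{}e s {}l le H lE ll']; first exact: FreeId.
by apply: (FreeNode le H); apply: perm_trans lE.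
Qed.

Lemma free_op_graft (T : tree) (s : T -> seq T) (l : seq T) (e : T) :
  free_op l e -> (forall c, c \in l -> free_op (s c) c) ->
  free_op (flatten [seq s c | c <- l]) e.
Proof.
elim=> [{}e H /=|{}e t {}l le _ IH lE H].
  by rewrite cats0; apply: H; rewrite mem_head.
apply: (FreeNode (s := fun c => flatten [seq s d | d <- t c]) le).
  move=> c cv; apply: IH => // d dc; apply: H.
  by rewrite (perm_mem lE); apply/flatten_mapP; exists c; rewrite ?mem_enum.
apply: perm_trans (perm_flatten (perm_map s lE)) _.
elim: (enum _) => //= c r IHr.
by rewrite map_cat flatten_cat perm_cat2l.
Qed.

Lemma card_above_lt (T : tree) (e c : T) : (e < c)%O ->
  (#|[set x : T | (c < x)%O]| < #|[set x : T | (e < x)%O]|)%N.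
Proof.
move=> ec; apply: proper_card; apply/properP; split.
  by apply/subsetP => x; rewrite !inE; apply: lt_trans.
by exists c; rewrite !inE ?ec // ltxx.
Qed.

Lemma closed_op0 (T : tree) (e : T) : closed_tree T -> free_op [::] e.
Proof.
move=> cT; have [n] := ubnP #|[set x : T | (e < x)%O]|.
elim: n e => // n IH e en; apply: (FreeNode (s := fun=> [::])).
- by rewrite cT in_set0.
- move=> c /inputs_gt ec; apply: IH.
  by rewrite -ltnS; apply: leq_trans en; rewrite ltnS; apply: card_above_lt.
- by elim: (enum _).
Qed.

Lemma minimal_below (T : tree) (e x : T) : (e < x)%O -> 
  exists2 c, c \in inputs e & (c <= x)%O.
Proof.
move=> ex.
pose P := [pred y : T | (e < y)%O && (y <= x)%O].
have Px : P x by rewrite /= ex lexx.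
case: (arg_minnP (fun y => #|[set z : T | (z <= y)%O]|) Px) => c /andP[ec cx] cmin.
exists c => //.
rewrite inE ec /=; apply/forallP => y; apply/implyP => /andP[ey yc].
apply: contraT => ync.
have /cmin : P y by rewrite /= ey (le_trans yc cx).
rewrite leqNgt => /negP; case; apply: proper_card; apply/properP; split.
  by apply/subsetP => z; rewrite !inE => /le_trans; apply.
exists c; rewrite !inE ?lexx //.
by apply: contra ync => cy; rewrite eq_le yc cy.
Qed.

Lemma closed_opP (T : tree) (l : seq T) (e : T) : closed_tree T ->
  free_op l e <-> [/\ uniq l, {in l, forall x, (e <= x)%O} &
    {in l &, forall x y : T, (x <= y)%O -> x = y}].
Proof.
move=> cT; split.
  move=> H; split; [exact: free_op_uniq H|by move=> x; exact: free_op_ge H|].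
  elim: H => [{}e x y|{}e s {}l _ H IH lE x y].
    by rewrite !inE => /eqP -> /eqP ->.
  rewrite !(perm_mem lE) => /flatten_mapP[c]; rewrite mem_enum => cv xc.
  move=> /flatten_mapP[d]; rewrite mem_enum => dv yd xy.
  have cx := free_op_ge (H _ cv) xc; have dy := free_op_ge (H _ dv) yd.
  have E := inputs_disjoint cv dv (le_trans cx xy) dy; rewrite -E in yd.
  exact: IH cv x y xc yd xy.
have [n] := ubnP #|[set x : T | (e < x)%O]|.
elim: n e l => // n IH e l en [ul le al].
have [el|nel] := boolP (e \in l).
  suff E : perm_eq l [:: e] by rewrite (perm_small_eq _ E) //; exact: FreeId.
  apply: uniq_perm => // x; rewrite inE; apply/idP/eqP => [xl|->//].
  by apply/esym/al => //; apply: le.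
apply: (FreeNode (s := fun c => [seq x <- l | (c <= x)%O])).
- by rewrite cT in_set0.
- move=> c cv; apply: IH.
    by rewrite -ltnS; apply: leq_trans en; rewrite ltnS; apply: card_above_lt; exact: inputs_gt.
  split; first exact: filter_uniq.
    by move=> x; rewrite mem_filter => /andP[].
  by move=> x y; rewrite !mem_filter => /andP[_ xl] /andP[_ yl]; apply: al.
- apply: uniq_perm => //.
    apply: uniq_flatten_map => [|c _|c c' x]; [exact: enum_uniq|exact: filter_uniq|].
    rewrite !mem_enum !mem_filter => cv cv' /andP[cx _] /andP[cx' _].
    exact: (inputs_disjoint cv cv' cx cx').
  move=> x; apply/idP/flatten_mapP => [xl|[c _]]; last by rewrite mem_filter => /andP[].
  have [|c cv cx] := @minimal_below T e x.
    rewrite lt_neqAle le // andbT; apply: contraNneq nel => ->; exact: xl.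
  by exists c; rewrite ?mem_enum // mem_filter cx.
Qed.

Lemma closed_op1 (T : tree) (e x : T) :
  closed_tree T -> (e <= x)%O -> free_op [:: x] e.
Proof.
move=> cT ex; rewrite closed_opP //; split=> // [y|y z]; rewrite !inE.
  by move/eqP ->.
by move=> /eqP -> /eqP ->.
Qed.

(* Omega^c is the category of finite rooted trees and maps that preserve the
   order and send incomparable pairs to incomparable pairs. *)
Lemma closed_homP (T T' : tree) (f : T -> T') : closed_tree T -> closed_tree T' ->
  (forall l e, free_op l e -> free_op (map f l) (f e)) <->
  ({homo f : x y / (x <= y)%O} /\ (forall x y : T, ~~ (x >=< y)%O -> ~~ (f x >=< f y)%O)).
Proof.
move=> cT cT'; split.
  move=> H; split.
    move=> x y xy; have := H [:: y] x; rewrite !closed_opP //= => -[].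
      split => // [z|z z']; rewrite !inE; first by move/eqP => ->.
      by move=> /eqP -> /eqP ->.
    by move=> _ h _; apply: h; rewrite mem_head.
  move=> x y nxy; have := H [:: x; y] (root T); rewrite !closed_opP //= => -[].
    split.
    - by rewrite inE andbT; apply: contra nxy => /eqP ->; rewrite comparablexx.
    - by move=> z _; apply: root_le.
    - move=> z z'; rewrite !inE => /orP[] /eqP -> /orP[] /eqP -> // h; move: nxy; rewrite /Order.comparable h ?orbT //.
  rewrite inE andbT => fxy _ al; apply: contra fxy => /orP[] h.
    by apply/eqP; apply: al; rewrite ?inE ?eqxx ?orbT.
  by apply/eqP/esym; apply: al; rewrite ?inE ?eqxx ?orbT.
move=> [fh fi] l e; rewrite !closed_opP // => -[ul le al].
have key x y : x \in l -> y \in l -> (f x <= f y)%O -> x = y.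
  move=> xl yl fxy; have [/orP[]|/fi] := boolP (x >=< y)%O.
  - exact: al.
  - by move=> h; apply/esym/al.
  - by rewrite /Order.comparable fxy.
split.
- by rewrite map_inj_in_uniq // => x y xl yl E; apply: key => //; rewrite E.
- by move=> _ /mapP[x xl ->]; apply: fh; apply: le.
- by move=> _ _ /mapP[x xl ->] /mapP[y yl ->] h; rewrite (key x y).
Qed.

(* A map into a closed tree extends to the closure of its source: this is the
   adjunction between closure and the inclusion of closed trees. *)
Program Definition closure_adj (T T' : tree) (cT' : closed_tree T')
    (f : omega_hom T T') : omega_hom (closure_tree T) T' :=
  @OmegaHom (closure_tree T) T' f _.
Next Obligation.
move=> T T' cT' f l e; elim=> [{}e|{}e s {}l _ _ IH lE]; first exact: FreeId.
apply: free_op_perm (perm_map f lE); rewrite map_flatten -map_comp.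
have [eL|eL] := boolP ((e : T) \in leaves T).
  suff -> : inputs e = set0 by rewrite enum_set0; exact: closed_op0.
  apply/setP => c; rewrite inE in_set0; apply/negbTE/negP => /andP[ec _].
  have := leaves_max eL (ltW ec) => E.
  by move: ec; rewrite E ltxx.
have gen : free_op (map f (enum (inputs (e : T)))) (f e).
  apply: oh_op; apply: (FreeNode (s := fun c => [:: c]) eL) => [c _|].
    exact: FreeId.
  by rewrite flatten_map1 map_id.
have /dinjectiveP fi := free_op_uniq gen.
pose t d := if [pick c in inputs (e : T) | f c == d] is Some c then map f (s c)
  else [::].
have tE c : c \in inputs (e : T) -> t (f c) = map f (s c).
  move=> cv; rewrite /t; case: pickP => [d /andP[dv /eqP fE]|/(_ c)].
    by rewrite (fi _ _ dv cv fE).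
  by rewrite /= cv eqxx.
have := free_op_graft (s := t) gen; rewrite -map_comp.
rewrite (_ : map _ _ = [seq map f (s c) | c <- enum (inputs (e : T))]); last first.
  by apply/eq_in_map => c; rewrite mem_enum => /= /tE.
apply=> d /mapP[c]; rewrite mem_enum => cv ->; rewrite tE //.
exact: IH.
Qed.

Program Definition to_closure (T : tree) : omega_hom T (closure_tree T) :=
  @OmegaHom T (closure_tree T) id _.
Next Obligation.
move=> T l e; rewrite map_id; elim=> [{}e|{}e s {}l _ _ IH lE].
  exact: FreeId.
by apply: (@FreeNode (closure_tree T) e s l); rewrite ?in_set0.
Qed.

(* T |-> T^c, as a functor from Omega to closed trees. *)
Program Definition closure : functor Omega OmegaC :=
  @Functor Omega OmegaC closure_ob
    (fun T T' f => @closure_adj T (closure_tree T') erefl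
                     (omega_comp (to_closure T') f)) _ _.
Next Obligation. by move=> *; apply: omega_homP. Qed.
Next Obligation. by move=> *; apply: omega_homP. Qed.

(* ({0 <= ... <= n}, {n}) *)
Program Definition linear_tree (n : nat) : tree :=
  @Tree Order.OrdinalOrder.ord_display
    (Order.FinPOrder.clone _ 'I_n.+1 _) ord0 _ _ [set ord_max] _.
Next Obligation. by move=> n x; rewrite leEord. Qed.
Next Obligation.
by move=> n x y z _ _; rewrite leEord; apply: leq_total.
Qed.
Next Obligation.
move=> n x y; rewrite in_set1 => /eqP ->; rewrite leEord.
by move=> /= ny; apply/val_inj/eqP; rewrite /= eqn_leq ny leq_ord.
Qed.

Definition eta_tree : tree := linear_tree 0.

Definition corolla_edge (n : nat) : Type := 'I_n.+1.
HB.instance Definition _ n := Finite.on (corolla_edge n).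

Definition corolla_le n : rel (corolla_edge n) :=
  fun x y => (x == ord0) || (x == y).

Fact corolla_refl n : reflexive (@corolla_le n).
Proof. by move=> x; rewrite /corolla_le eqxx orbT. Qed.

Fact corolla_anti n : antisymmetric (@corolla_le n).
Proof.
move=> x y /andP[/orP[/eqP->|/eqP -> //] /orP[/eqP-> //|/eqP -> //]].
Qed.

Fact corolla_trans n : transitive (@corolla_le n).
Proof.
move=> y x z /orP[/eqP->|/eqP -> //]; first by rewrite /corolla_le eqxx.
Qed.

HB.instance Definition _ n :=
  Order.Le_isPOrder.Build Order.OrdinalOrder.ord_display (corolla_edge n)
    (@corolla_refl n) (@corolla_anti n) (@corolla_trans n).

Lemma corolla_leE n (x y : corolla_edge n) :
  (x <= y)%O = (x == ord0) || (x == y).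
Proof. by []. Qed.

Program Definition corolla (n : nat) : tree :=
  @Tree _ (Order.FinPOrder.clone _ (corolla_edge n) _) ord0 _ _
    [set i | i != ord0] _.
Next Obligation. by move=> n x; rewrite corolla_leE eqxx. Qed.
Next Obligation.
move=> n x y z; rewrite !corolla_leE.
by case/orP=> [/eqP ->|/eqP ->]; rewrite ?eqxx // => /orP[] /eqP ->;
  rewrite !eqxx ?orbT.
Qed.
Next Obligation.
by move=> n x y; rewrite inE corolla_leE => /negPf -> /= /eqP.
Qed.

(* None codes eta, Some n codes the n-corolla. *)
Definition elementary (c : option nat) : tree :=
  if c is Some n then corolla n else eta_tree.

Definition subtree_inclusion (T T' : tree) (f : omega_hom T T') : Prop :=
  injective f /\
  forall (e0 e2 : T) (e' : T'),
    (f e0 <= e')%O -> (e' <= f e2)%O -> exists e, f e = e'.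

(* The category (Omega^el)_{/T}. *)
Record el_ob (T : tree) := ElOb {
  el_code : option nat;
  el_map : omega_hom (elementary el_code) T;
  el_sub : subtree_inclusion el_map;
  el_valence : if el_code is Some n
    then #|inputs (el_map (root (elementary el_code)))| = n else True }.

Definition el_hom (T : tree) (X Y : el_ob T) :=
  {g : omega_hom (elementary (el_code X)) (elementary (el_code Y))
     | omega_comp (el_map Y) g = el_map X}.

Program Definition el (T : tree) : cat :=
  @Cat (el_ob T) (@el_hom T) (fun X => exist _ (omega_id _) _)
    (fun X Y Z g f => exist _ (omega_comp (sval g) (sval f)) _) _ _ _.
Next Obligation. by move=> *; apply: omega_homP. Qed.
Next Obligation. by move=> T X Y Z [g gE] [f fE] /=; rewrite -fE -gE; apply: omega_homP. Qed.
Next Obligation. by move=> T X Y [f fE]; apply: eq_exist; apply: omega_homP. Qed.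
Next Obligation. by move=> T X Y [f fE]; apply: eq_exist; apply: omega_homP. Qed.
Next Obligation. by move=> *; apply: eq_exist; apply: omega_homP. Qed.

Definition el_forget (T : tree) : functor (el T) Omega :=
  @Functor (el T) Omega (fun X => elementary (el_code X)) (fun X Y g => sval g)
    (fun _ => erefl) (fun _ _ _ _ _ => erefl).

(* X |-> F(X^c) on ((Omega^el)_{/T})^op, with its cone from F(T). *)
Definition segal_diagram (F : spsh OmegaC) (T : OmegaC) :
    diagram (opc (el (fs_ob T))) :=
  pull (opf (fcomp closure (el_forget (fs_ob T)))) F.

Definition el_closure_map (T : OmegaC) (X : el (fs_ob T)) :
    @hom OmegaC (closure_ob (elementary (el_code X))) T :=
  closure_adj (fs_prop T) (el_map X).

Program Definition segal_cone (F : spsh OmegaC) (T : OmegaC) :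
    cone (F T) (segal_diagram F T) :=
  @Cone _ (F T) (segal_diagram F T)
    (fun X => @dmap _ F T (closure_ob (elementary (el_code X))) (el_closure_map X)) _.
Next Obligation.
move=> F T X Y [g gE] n z; rewrite /= -(dmapM F).
apply: (congr1 (fun h => @dmap _ F T (closure_ob (elementary (el_code Y))) h n z)).
by apply: omega_homP => e; rewrite /= -gE.
Qed.

Definition segal_presheaf (F : spsh OmegaC) : Prop :=
  forall T : OmegaC, weq (to_holim (segal_cone F T)).

(* Simplicial spaces W; W n is the space of n-simplices. For the W = r^* F below
   with F injectively fibrant, W is Reedy fibrant (r is the
   inclusion of a sieve), so that the fibres and fibre
   products below are the homotopy ones. *)

Definition coface n (i : 'I_n.+2) : simp n n.+1.
Proof.
exists (lift i) => a b ab; rewrite /= /bump; apply: leq_add => //.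
by case: (leqP i a) => // ia; rewrite (leq_trans ia ab).
Defined.

Definition spine_edge n (i : 'I_n) : simp 1 n.
Proof.
exists (fun k : 'I_2 => inord (i + k)) => a b ab.
have lt (k : 'I_2) : (i + k < n.+1)%N.
  by rewrite ltnS (leq_trans (leq_add (leqnn i) (leq_ord k))) // addn1.
by rewrite !inordK ?lt // leq_add2l.
Defined.

Section Rezk.
Variable W : spsh delta.

Definition face n (i : 'I_n.+2) : smap (W n.+1) (W n) :=
  @dmap _ W n.+1 n (coface i).
Definition source : smap (W 1) (W 0) := @dmap _ W 1 0 (simp_const 0 ord0).
Definition target : smap (W 1) (W 0) := @dmap _ W 1 0 (simp_const 0 ord_max).
Definition degen n : smap (W 0) (W n) := @dmap _ W 0 n (simp_const n ord0).

Program Definition spine_product (n : nat) : sset :=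
  @SSet (fun m => {x : 'I_n -> W 1 m |
      forall i j : 'I_n, j = i.+1 :> nat -> target m (x i) = source m (x j)})
    (fun l m f x => exist _ (fun i => act f (sval x i)) _) _ _.
Next Obligation. by move=> n l m f [x xP] i j ij; rewrite /= !smap_act (xP i j ij). Qed.
Next Obligation.
by move=> n m [x xP]; apply: eq_exist; apply: funext => i; rewrite /= act1.
Qed.
Next Obligation.
by move=> n k l m f g [x xP]; apply: eq_exist; apply: funext => i; rewrite /= actM.
Qed.

Program Definition spine_map (n : nat) : smap (W n) (spine_product n) :=
  @SMap _ (spine_product n)
    (fun m x => exist _ (fun i => @dmap _ W n 1 (spine_edge i) m x) _) _.
Next Obligation.
move=> n m x i j ij; rewrite /target /source -!(dmapM W).
apply: (congr1 (fun h : simp 0 n => @dmap _ W n 0 h m x)).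
by apply: simpP => k; rewrite /= ij addn0 addn1.
Qed.
Next Obligation.
move=> n l m f x; apply: eq_exist; apply: funext => i /=; exact: smap_act.
Qed.

Definition segal_space : Prop := forall n, 0 < n -> weq (spine_map n).

(* f and g lie in the same component of map_W(x, y), the fibre of
   (source, target) over their common endpoints. *)
Definition map_path (f g : W 1 0) : Prop :=
  exists e : W 1 1,
    [/\ act (simp_const 0 ord0) e = f, act (simp_const 0 ord_max) e = g,
        source 1 e = act (simp_const 1 ord0) (source 0 f) &
        target 1 e = act (simp_const 1 ord0) (target 0 f)].

Definition map_homotopic : W 1 0 -> W 1 0 -> Prop := clos_refl_sym_trans _ map_path.

(* Rezk's homotopy equivalences: s and t witness composites g . f and h . g that
   are homotopic to identities. *)
Definition hoequiv (g : W 1 0) : Prop :=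
  (exists s : W 2 0, face ord0 0 s = g /\
     map_homotopic (face (@Ordinal 3 1 isT) 0 s) (degen 1 0 (target 0 g))) /\
  (exists t : W 2 0, face ord_max 0 t = g /\
     map_homotopic (face (@Ordinal 3 1 isT) 0 t) (degen 1 0 (source 0 g))).

Lemma degen_comp k l (f : simp k l) m (x : W 0 m) :
  @dmap _ W l k f m (degen l m x) = degen k m x.
Proof.
rewrite /degen -(dmapM W).
apply: (congr1 (fun h : simp k 0 => @dmap _ W 0 k h m x)).
by apply: simpP => i; apply: val_inj.
Qed.

Lemma hoequiv_degen (x : W 0 0) : hoequiv (degen 1 0 x).
Proof.
split; exists (degen 2 0 x); rewrite /face /source /target !degen_comp.
  by split=> //; apply: rst_refl.
by split=> //; apply: rst_refl.
Qed.

Program Definition hoequiv_space : sset :=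
  @sub_sset (W 1) (fun m x => forall i : simp 0 m, hoequiv (act i x)) _.
Next Obligation. by move=> l m f x H i /=; rewrite -actM. Qed.

Program Definition degen_hoequiv : smap (W 0) hoequiv_space :=
  @SMap (W 0) hoequiv_space (fun m x => exist _ (degen 1 m x) _) _.
Next Obligation. by move=> m x i /=; rewrite -smap_act; apply: hoequiv_degen. Qed.
Next Obligation. by move=> *; apply: eq_exist; rewrite /= smap_act. Qed.

Definition complete_segal_space : Prop := segal_space /\ weq degen_hoequiv.

End Rezk.

Lemma linear_inputs n (e c : linear_tree n) : c \in inputs e -> c = e.+1 :> nat.
Proof.
move=> cv; have := inputs_gt cv; rewrite ltEord => ec.
have en : (e.+1 < n.+1)%N by apply: leq_trans ec (leq_ord c).
suff /(congr1 val) /= <- : Ordinal en = c by [].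
apply: (inputs_min cv); first by rewrite ltEord.
by rewrite leEord.
Qed.

Lemma linear_op n (l : seq (closure_tree (linear_tree n)))
    (e : closure_tree (linear_tree n)) :
  free_op l e -> l = [::] \/ exists x, l = [:: x].
Proof.
elim=> [{}e|{}e s {}l _ _ IH lE]; first by right; exists e.
have : (size (enum (inputs e)) <= 1)%N.
  rewrite -cardE; apply/card_le1_eqP => c c' /linear_inputs cE /linear_inputs cE'.
  by apply: val_inj; rewrite /= cE cE'.
case E : (enum (inputs e)) lE => [|c [|//]] /= lE _.
  by left; apply/perm_nilP.
rewrite cats0 in lE; have cv : c \in inputs e by rewrite -mem_enum E mem_head.
case: (IH c cv) lE => [->|[x ->]] lE; first by left; apply/perm_nilP.
by right; exists x; apply: perm_small_eq lE.
Qed.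

Program Definition linear_map m n (f : simp m n) :
    @hom OmegaC (closure_ob (linear_tree m)) (closure_ob (linear_tree n)) :=
  @OmegaHom (closure_tree (linear_tree m)) (closure_tree (linear_tree n)) f _.
Next Obligation.
move=> m n f l e le; case: (linear_op le) => [lE|[x lE]].
  by rewrite lE; apply: closed_op0.
rewrite lE in le *; have := free_op_ge le (mem_head x [::]) => ex.
exact: (@closed_op1 (closure_tree (linear_tree n)) _ _ erefl (simp_homo f ex)).
Qed.

Program Definition linear_functor : functor delta OmegaC :=
  @Functor delta OmegaC (fun n => closure_ob (linear_tree n)) linear_map _ _.
Next Obligation. by move=> n; apply: omega_homP. Qed.
Next Obligation. by move=> *; apply: omega_homP. Qed.

Definition complete_presheaf (F : spsh OmegaC) : Prop :=
  complete_segal_space (pull (opf linear_functor) F).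

(* The objects of Op^un, as a full subcategory of P(Omega^c). *)
Definition unital_operad (F : spsh OmegaC) : Prop :=
  [/\ inj_fibrant F, segal_presheaf F & complete_presheaf F].

Definition dendroidal (k : nat) (T : OmegaC) : Prop :=
  forall e : fs_ob T, (#|inputs e| <= k)%N.

Definition OmegaC_le (k : nat) : cat := fullsub (dendroidal k).

Definition incl (k : nat) : functor (OmegaC_le k) OmegaC :=
  fullsub_incl (dendroidal k).

Lemma dendroidal_le k k' : (k <= k')%N ->
  forall T, dendroidal k T -> dendroidal k' T.
Proof. by move=> kk' T dT e; apply: leq_trans kk'. Qed.

Definition restrict (k : nat) (F : spsh OmegaC) : spsh (OmegaC_le k) :=
  pull (opf (incl k)) F.

Definition Lan_le (k : nat) (F : spsh (OmegaC_le k)) : spsh OmegaC := lan (incl k) F.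

Definition L_counit (k : nat) (P : spsh OmegaC) : nat_tr (Lan_le (restrict k P)) P :=
  lan_counit (incl k) P.

Lemma eq_lan_simplex_fullsub (C : cat) (Q : C -> Prop) (F : spsh C) (T : C) n
    (o : ordc n -> C) q q' m e e' c c' g x :
  @LanSimplex (fullsub Q) C (fullsub_incl Q) (pull (opf (fullsub_incl Q)) F) T n
    (@Functor (ordc n) (fullsub Q) (fun i => @FullSub C Q (o i) (q i)) m e c) g x =
  @LanSimplex (fullsub Q) C (fullsub_incl Q) (pull (opf (fullsub_incl Q)) F) T n
    (@Functor (ordc n) (fullsub Q) (fun i => @FullSub C Q (o i) (q' i)) m e' c') g x.
Proof.
have E : q = q' by apply: functional_extensionality_dep => i.
by case: _ / E e' c' => e' c'; apply: eq_lan_simplex.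
Qed.

(* L_k P^k -> L_k' P^k' for k <= k': a simplex of the left Kan extension along
   Omega^c_{<= k} is one of the left Kan extension along Omega^c_{<= k'}. Since
   i_k = i_k' o j for the inclusion j, this is L_k' applied to the counit
   j_! j^* P^k' -> P^k'. *)
Program Definition L_map (P : spsh OmegaC) (k k' : nat) (kk' : (k <= k')%N) :
    nat_tr (Lan_le (restrict k P)) (Lan_le (restrict k' P)) :=
  @NatTr (opc OmegaC) _ _ (fun T => @SMap _ _ (fun n s =>
    @LanSimplex _ _ (incl k') (restrict k' P) T n
      (fcomp (fullsub_sub (dendroidal_le kk')) (ls_chain s))
      (ls_map s) (ls_val s)) _) _.
Next Obligation.
by move=> P k k' kk' T m n f [[o h e c] g x]; apply: eq_lan_simplex.
Qed.
Next Obligation. by []. Qed.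

Definition nat_pos : cat := @fullsub natc (fun k : nat => (0 < k)%N).

Program Definition filtration (P : spsh OmegaC) : psh_diagram nat_pos OmegaC :=
  @PshDiagram nat_pos OmegaC (fun k => Lan_le (restrict (fs_ob k) P))
    (fun k k' kk' => L_map P kk') _ _.
Next Obligation.
move=> P k T n [[o m e c] g x]; exact: eq_lan_simplex_fullsub.
Qed.
Next Obligation.
move=> P k k' k'' kk' kk'' T n [[o m e c] g x]; exact: eq_lan_simplex_fullsub.
Qed.

Program Definition counits (P : spsh OmegaC) : cocone (filtration P) P :=
  @Cocone nat_pos OmegaC (filtration P) P (fun k => L_counit (fs_ob k) P) _.
Next Obligation. by []. Qed.

(* Main.v *)
(* The homotopy limit of the spaces Map(L_k O, P) is Map(H, P), where H is the bar
   construction of the homotopy colimit of the L_k O. So it suffices that the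
   canonical map q : H -> O becomes a homotopy equivalence under Map(-, P).
   Let T be a k-dendroidal tree. A simplex of H(T) is a chain of indices, a chain of
   trees under T whose valences are bounded by the smallest index, and a simplex of
   O on the last tree. The space H(T) contracts onto O(T), fibrewise over O(T): raise
   the indices to at least k, then replace the trees by T, then lower the indices
   to k. This is not natural in T, but the injective fibrancy of P allows one to
   extend a map H -> P along q up to homotopy, and applying the same to the double
   mapping cylinder of q shows that extensions are unique up to homotopy. *)

From mathcomp Require Import all_boot all_order.
From mathcomp Require Import boolp.
From Stdlib Require Import Relation_Operators.
Require Import Defs.

Set Implicit Arguments.
Unset Strict Implicit.
Unset Printing Implicit Defensive.

Local Obligation Tactic := idtac.
Local Open Scope cat_scope.

(** * Homotopies, homotopy equivalences and weak equivalences of simplicial sets *)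

Definition smap_id (X : sset) : smap X X :=
  @SMap X X (fun n x => x) (fun _ _ _ _ => erefl).

Lemma smap_compA (X Y Z W : sset) (h : smap Z W) (g : smap Y Z) (f : smap X Y) :
  smap_comp h (smap_comp g f) = smap_comp (smap_comp h g) f.
Proof. exact: smapP. Qed.

Lemma smap_compm1 (X Y : sset) (f : smap X Y) : smap_comp f (smap_id X) = f.
Proof. exact: smapP. Qed.

Lemma homotopicW (X Y : sset) (f g : smap X Y) : homotopy f g -> homotopic f g.
Proof. exact: rst_step. Qed.

Lemma homotopic_refl (X Y : sset) (f : smap X Y) : homotopic f f.
Proof. exact: rst_refl. Qed.

Lemma homotopic_sym (X Y : sset) (f g : smap X Y) :
  homotopic f g -> homotopic g f.
Proof. exact: rst_sym. Qed.

Lemma homotopic_trans (X Y : sset) (g f h : smap X Y) :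
  homotopic f g -> homotopic g h -> homotopic f h.
Proof. exact: rst_trans. Qed.

Lemma homotopic_compl (X Y Z : sset) (g : smap Y Z) (f f' : smap X Y) :
  homotopic f f' -> homotopic (smap_comp g f) (smap_comp g f').
Proof.
elim=> [{}f {}f' [H HE]|{}f|{}f {}f' _ |{}f h {}f' _ IH1 _ IH2].
- apply: homotopicW; exists (smap_comp g H) => n x /=.
  by have [-> ->] := HE n x.
- exact: homotopic_refl.
- exact: homotopic_sym.
- exact: homotopic_trans IH1 IH2.
Qed.

Lemma homotopic_compr (X Y Z : sset) (f : smap X Y) (g g' : smap Y Z) :
  homotopic g g' -> homotopic (smap_comp g f) (smap_comp g' f).
Proof.
elim=> [{}g {}g' [H HE]|{}g|{}g {}g' _ |{}g h {}g' _ IH1 _ IH2].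
- apply: homotopicW.
  unshelve eexists (@SMap (sprod X (std 1)) Z (fun n p => H n (f n p.1, p.2)) _).
    by move=> m n s [x t] /=; rewrite -smap_act /= smap_act.
  by move=> n x; exact: HE.
- exact: homotopic_refl.
- exact: homotopic_sym.
- exact: homotopic_trans IH1 IH2.
Qed.

Definition hequiv (X Y : sset) (f : smap X Y) : Prop :=
  exists2 g : smap Y X, homotopic (smap_comp g f) (smap_id X) &
    homotopic (smap_comp f g) (smap_id Y).

Lemma hequiv_weq (X Y : sset) (f : smap X Y) : hequiv f -> weq f.
Proof.
case=> g gf fg K _; split=> [u|u v uv].
  exists (smap_comp u g); rewrite -smap_compA -[X in homotopic _ X]smap_compm1.
  exact: homotopic_compl.
have cancel (w : smap Y K) : homotopic (smap_comp (smap_comp w f) g) w.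
  rewrite -smap_compA -[X in homotopic _ X]smap_compm1.
  exact: homotopic_compl.
apply: homotopic_trans (homotopic_sym (cancel u)) _.
exact: homotopic_trans (homotopic_compr g uv) (cancel v).
Qed.

Lemma weq_comp (X Y Z : sset) (g : smap Y Z) (f : smap X Y) :
  weq f -> weq g -> weq (smap_comp g f).
Proof.
move=> wf wg K kK; split=> [u|u v]; last first.
  by rewrite !smap_compA => /(proj2 (wf K kK)) /(proj2 (wg K kK)).
have [v vu] := proj1 (wf K kK) u; have [w wv] := proj1 (wg K kK) v.
exists w; rewrite smap_compA.
exact: homotopic_trans (homotopic_compr f wv) vu.
Qed.

Lemma weq_cancel (X Y Z : sset) (g : smap Y Z) (f : smap X Y) :
  weq g -> weq (smap_comp g f) -> weq f.
Proof.
move=> wg wgf K kK; split=> [u|u v uv].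
  have [w wu] := proj1 (wgf K kK) u.
  by exists (smap_comp w g); rewrite -smap_compA.
have [u' uE] := proj1 (wg K kK) u; have [v' vE] := proj1 (wg K kK) v.
suff u'v' : homotopic u' v'.
  apply: homotopic_trans (homotopic_sym uE) _.
  exact: homotopic_trans (homotopic_compr g u'v') vE.
apply: (proj2 (wgf K kK)); rewrite !smap_compA.
apply: homotopic_trans (homotopic_compr f uE) _.
exact: homotopic_trans uv (homotopic_sym (homotopic_compr f vE)).
Qed.

Lemma iso_weq (X Y : sset) (f : smap X Y) (g : smap Y X) :
  (forall n, cancel (f n) (g n)) -> (forall n, cancel (g n) (f n)) -> weq f.
Proof.
move=> fK gK; apply: hequiv_weq; exists g.
  by rewrite (_ : smap_comp g f = smap_id X); [exact: homotopic_refl|apply: smapP].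
by rewrite (_ : smap_comp f g = smap_id Y); [exact: homotopic_refl|apply: smapP].
Qed.

(** * Factoring maps into an injectively fibrant diagram through objectwise equivalences *)

(* The cofree simplicial set on the pointed sets [option (X m)]: a map into it is
   an arbitrary family of functions, so that every presheaf embeds naturally into
   an objectwise contractible one. *)
Program Definition cofree (X : sset) : sset :=
  @SSet (fun n => forall m, simp m n -> option (X m))
    (fun m n f e l g => e l (simp_comp f g)) _ _.
Next Obligation.
move=> X n e; apply: functional_extensionality_dep => l; apply: funext => g.
by rewrite simp_comp1m.
Qed.
Next Obligation.
move=> X l m n f g e; apply: functional_extensionality_dep => k.
by apply: funext => h; rewrite simp_compA.
Qed.

Program Definition to_cofree (X : sset) : smap X (cofree X) :=
  @SMap X (cofree X) (fun n x m f => Some (act f x)) _.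
Next Obligation.
move=> X m n f x; apply: functional_extensionality_dep => k.
by apply: funext => h /=; rewrite actM.
Qed.

(** A contraction of [cofree X] to the point with all values [None]: a value at [f] survives only
    while the parameter is 0 along all of [f]. The values of a simplex are independent of each
    other, so erasing some of them is harmless. *)
Program Definition fade (X : sset) : smap (sprod (cofree X) (std 1)) (cofree X) :=
  @SMap (sprod (cofree X) (std 1)) (cofree X)
    (fun n p m f => if p.2 (f ord_max) == ord0 then p.1 m f else None) _.
Next Obligation. by []. Qed.

(** A substitute for the mapping cylinder of a map from [D] to [Y]. The transition maps preserve
    [None], which makes the base copy of [Y] and the contraction [fade] natural in [j]. *)
Program Definition graph_diagram (J : cat) (D Y : diagram J) : diagram J :=
  @Diagram J (fun j => sprod (Y j) (cofree (D j)))
    (fun i j f => @SMap (sprod (Y i) (cofree (D i))) (sprod (Y j) (cofree (D j)))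
      (fun n p => (dmap Y f n p.1, fun m g => omap (dmap D f m) (p.2 m g))) _) _ _.
Next Obligation. by move=> *; rewrite /= smap_act. Qed.
Next Obligation.
move=> J D Y i n [y e] /=; rewrite dmap1; congr (_, _).
apply: functional_extensionality_dep => m; apply: funext => g.
by case: (e m g) => //= x; rewrite dmap1.
Qed.
Next Obligation.
move=> J D Y i j k g f n [y e] /=; rewrite dmapM; congr (_, _).
apply: functional_extensionality_dep => m; apply: funext => h.
by case: (e m h) => //= x; rewrite dmapM.
Qed.

Section Extension.
Variables (J : cat) (D Y : diagram J) (r : nat_tr D Y).

Program Definition graph : nat_tr D (graph_diagram D Y) :=
  @NatTr J D (graph_diagram D Y) (fun j => @SMap (D j) (graph_diagram D Y j)
    (fun n x => (r j n x, to_cofree (D j) n x)) _) _.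
Next Obligation.
move=> j m n f x; congr (_, _); first exact: smap_act.
exact: (smap_act (to_cofree (D j))).
Qed.
Next Obligation.
move=> i j f n x /=; rewrite nt_nat; congr (_, _).
apply: functional_extensionality_dep => m; apply: funext => g /=.
by rewrite smap_act.
Qed.

Program Definition graph_base : nat_tr Y (graph_diagram D Y) :=
  @NatTr J Y (graph_diagram D Y) (fun j => @SMap (Y j) (graph_diagram D Y j)
    (fun n y => (y, fun _ _ => None)) _) _.
Next Obligation. by []. Qed.
Next Obligation. by []. Qed.

Program Definition graph_fade : nat_tr (dprod D (std 1)) (graph_diagram D Y) :=
  @NatTr J (dprod D (std 1)) (graph_diagram D Y)
   (fun j => @SMap (dprod D (std 1) j) (graph_diagram D Y j)
    (fun n p => (r j n p.1, fade (D j) n (to_cofree (D j) n p.1, p.2))) _) _.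
Next Obligation.
move=> j m n f [x t]; congr (_, _); first exact: smap_act.
rewrite -smap_act; congr (fade _ _ (_, _)).
exact: (smap_act (to_cofree (D j))).
Qed.
Next Obligation.
move=> i j f n [x t] /=; rewrite nt_nat; congr (_, _).
apply: functional_extensionality_dep => m; apply: funext => g /=.
by case: ifP => //= _; rewrite smap_act.
Qed.

Lemma graph_inj : objectwise_inj graph.
Proof.
move=> j n x y [_ E]; have := congr1 (fun e => e n (simp_id n)) E.
by rewrite /= !act1 => -[].
Qed.

(** The projection [p] to [Y] is an equivalence, as [fade] contracts the other factor, and [p] after
    [graph] is [r]; two out of three then applies. *)
Lemma graph_weq : (forall j, hequiv (r j)) -> objectwise_weq graph.
Proof.
move=> hr j.
pose p := @SMap (graph_diagram D Y j) (Y j) (fun n z => z.1) (fun _ _ _ _ => erefl).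
have hp : hequiv p.
  exists (graph_base j); last first.
    rewrite (_ : smap_comp _ _ = smap_id (Y j)); last exact: smapP.
    exact: homotopic_refl.
  apply/homotopic_sym/homotopicW.
  unshelve eexists (@SMap (sprod (graph_diagram D Y j) (std 1)) (graph_diagram D Y j)
    (fun n q => (q.1.1, fade (D j) n (q.1.2, q.2))) _).
    by move=> m n f [[y e] t].
  by move=> n [y e].
apply: weq_cancel (hequiv_weq hp) _; apply: hequiv_weq.
by rewrite (_ : smap_comp _ _ = r j) //; apply: smapP.
Qed.

(** Fibrancy extends [a] along [graph]. Restricting the extension to the base copy of [Y] gives [b],
    and fading the graph gives the homotopy. Both are natural in [j], although the homotopy inverses
    of the [r j] need not be. *)
Lemma factor_up_to_homotopy (P : diagram J) (a : nat_tr D P) :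
  inj_fibrant P -> (forall j, hequiv (r j)) ->
  exists (b : nat_tr Y P) (h : nat_tr (dprod D (std 1)) P),
    (forall j n (x : D j n), h j n (const_at ord0 x) = a j n x) /\
    (forall j n (x : D j n), h j n (const_at ord_max x) = b j n (r j n x)).
Proof.
move=> fP hr; have [e eE] := fP _ _ graph graph_inj (graph_weq hr) a.
exists (nat_comp e graph_base), (nat_comp e graph_fade).
by split=> [j n x|//]; rewrite -eE.
Qed.

End Extension.

(** * Homotopies over a base and the double mapping cylinder *)

(* Homotopies over Y. The double mapping cylinder of q is functorial in such maps
   only. *)
Definition vhomotopy (X Y : sset) (q : smap X Y) (u v : smap X X) : Prop :=
  exists2 H : smap (sprod X (std 1)) X,
    forall n x t, q n (H n (x, t)) = q n x &
    forall n (x : X n), H n (const_at ord0 x) = u n x /\ H n (const_at ord_max x) = v n x.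

Definition vhomotopic (X Y : sset) (q : smap X Y) : smap X X -> smap X X -> Prop :=
  clos_refl_sym_trans _ (vhomotopy q).

Definition shrinkable (X Y : sset) (q : smap X Y) : Prop :=
  exists2 s : smap Y X, (forall n y, q n (s n y) = y) &
    vhomotopic q (smap_comp s q) (smap_id X).

Definition vertical (X Y : sset) (q : smap X Y) (u : smap X X) : Prop :=
  forall n x, q n (u n x) = q n x.

Lemma vhomotopic_homotopic (X Y : sset) (q : smap X Y) (u v : smap X X) :
  vhomotopic q u v -> homotopic u v.
Proof.
elim=> [{}u {}v [H _ HE]|{}u|{}u {}v _|{}u w {}v _ uw _ wv].
- by apply: homotopicW; exists H.
- exact: homotopic_refl.
- exact: homotopic_sym.
- exact: homotopic_trans uw wv.
Qed.

Lemma shrinkable_hequiv (X Y : sset) (q : smap X Y) : shrinkable q -> hequiv q.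
Proof.
case=> s qs sq; exists s; first exact: vhomotopic_homotopic sq.
rewrite (_ : smap_comp q s = smap_id Y); first exact: homotopic_refl.
exact: smapP.
Qed.

Definition sprod_map (X Y A : sset) (f : smap X Y) : smap (sprod X A) (sprod Y A).
Proof.
exists (fun n p => (f n p.1, p.2)).
by move=> m n g [x a]; congr (_, _); exact: smap_act.
Defined.

(** Needed for products with mapping spaces, on which the evaluation maps are defined. *)
Lemma shrinkable_sprod (X Y A : sset) (q : smap X Y) :
  shrinkable q -> shrinkable (sprod_map A q).
Proof.
case=> s qs sq; exists (sprod_map A s) => [n [y a] /=|]; first by rewrite qs.
suff lift u v : vhomotopic q u v ->
    vhomotopic (sprod_map A q) (sprod_map A u) (sprod_map A v).
  have -> : smap_comp (sprod_map A s) (sprod_map A q) = sprod_map A (smap_comp s q).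
    exact: smapP.
  rewrite [X in vhomotopic _ _ X](_ : _ = sprod_map A (smap_id X)); first exact: lift.
  by apply: smapP => n [].
elim=> [{}u {}v [H qH HE]|{}u|{}u {}v _|{}u w {}v _ uw _ wv].
- apply: rst_step.
  unshelve eexists (@SMap (sprod (sprod X A) (std 1)) (sprod X A)
    (fun n p => (H n (p.1.1, p.2), p.1.2)) _).
  + by move=> m n g [[x a] t]; congr (_, _); rewrite -smap_act.
  + by move=> n [x a] t; congr (_, _); exact: qH.
  + by move=> n [x a]; have [Hu Hv] := HE n x; split; congr (_, _).
- exact: rst_refl.
- exact: rst_sym.
- exact: rst_trans uw wv.
Qed.

Definition simp_cst n (t : simp n 1) : bool := t ord0 == t ord_max.

Lemma simp_cstP n (t : simp n 1) : simp_cst t -> forall i, t i = t ord0.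
Proof.
move=> /eqP tE i; apply/val_inj/eqP; rewrite eqn_leq {1}tE.
by rewrite !simp_homo ?leq_ord.
Qed.

Lemma simp_cst_const m n (f : simp m n) (t : simp n 1) :
  simp_cst t -> simp_cst (simp_comp t f).
Proof. by move=> /simp_cstP tE; rewrite /simp_cst /= !(tE (f _)). Qed.

Lemma simp_cst_constE n (t : simp n 1) : simp_cst t -> t = simp_const n (t ord0).
Proof. by move=> /simp_cstP tE; apply: simpP. Qed.

(* The double mapping cylinder of q, that is X x D^1 with q glued in at both ends.
   A simplex (y, t, o) with t constant lies in one of the two copies of Y; otherwise
   o = Some x with q x = y, and it is the simplex (x, t) of X x D^1. *)
Section DoubleCylinder.
Variables (X Y : sset) (q : smap X Y).

Definition dcyl_valid n (p : Y n * simp n 1 * option (X n)) : Prop :=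
  if p.2 is Some x then ~~ simp_cst p.1.2 /\ q n x = p.1.1 else simp_cst p.1.2.

(** Where the parameter becomes constant, the simplex falls into an end and only its image in [Y] is
    kept. *)
Definition dcyl_act m n (f : simp m n) (p : Y n * simp n 1 * option (X n)) :
    Y m * simp m 1 * option (X m) :=
  (act f p.1.1, simp_comp p.1.2 f,
   if simp_cst (simp_comp p.1.2 f) then None else omap (act f) p.2).

Lemma dcyl_act_valid m n (f : simp m n) p : dcyl_valid p -> dcyl_valid (dcyl_act f p).
Proof.
case: p => -[y t] [x|]; rewrite /dcyl_valid /=; last by move/(simp_cst_const f) => ->.
case=> tc qx; case: ifP => // tfc; split=> //.
by rewrite smap_act qx.
Qed.

Program Definition dcyl : sset :=
  @SSet (fun n => {p | @dcyl_valid n p})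
    (fun m n f p => exist _ (dcyl_act f (sval p)) (dcyl_act_valid f (svalP p))) _ _.
Next Obligation.
move=> n [[[y t] o] h]; apply: eq_exist; rewrite /dcyl_act /= act1 simp_compm1.
congr (_, _, _); case: o h => [x [/negPf /= -> _]|/= ->] //=.
by rewrite act1.
Qed.
Next Obligation.
move=> l m n f g [[[y t] o] h]; apply: eq_exist; rewrite /dcyl_act /= actM -simp_compA.
congr (_, _, _); case: (boolP (simp_cst (simp_comp t g))) => [c|_]; last first.
  by case: o h => //= x _; rewrite actM.
by rewrite simp_compA simp_cst_const.
Qed.

Definition dcyl_proj : smap dcyl Y :=
  @SMap dcyl Y (fun n p => (sval p).1.1) (fun _ _ _ _ => erefl).

Program Definition dcyl_end (e : 'I_2) : smap Y dcyl :=
  @SMap Y dcyl (fun n y => exist _ (y, simp_const n e, None) _) _.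
Next Obligation. by move=> e n y; rewrite /dcyl_valid /simp_cst /=. Qed.
Next Obligation.
move=> e m n f y; apply: eq_exist; rewrite /dcyl_act /=; congr (_, _, _).
by case: ifP.
Qed.

(** The universal property of the cylinder as a pushout. In the branch without a simplex of [X] the
    parameter is constant, so its value at [ord0] names the end. *)
Definition dcyl_rec (Z : sset) (b : 'I_2 -> smap Y Z)
    (h : smap (sprod X (std 1)) Z)
    (hb : forall e n (x : X n), h n (const_at e x) = b e n (q n x)) : smap dcyl Z.
Proof.
exists (fun n p => if (sval p).2 is Some x then h n (x, (sval p).1.2)
                   else b ((sval p).1.2 ord0) n (sval p).1.1).
move=> m n f [[[y t] [x|]] /= v].
  case: v => tc qx /=; case: ifP => /= [tfc|_]; last by rewrite -smap_act.
  rewrite -smap_act /= [X in h m (_, X)]simp_cst_constE //.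
  by rewrite [RHS]hb /= !smap_act qx.
rewrite if_same (_ : t (f ord0) = t ord0) ?smap_act //.
by rewrite simp_cstP.
Defined.

(** The homotopy acts on the simplex of [X] alone and leaves the point of [Y] and the cylinder
    coordinate in place; this is where it has to lie over [Y]. *)
Program Definition dcyl_fiber
    (H : smap (sprod X (std 1)) X)
    (qH : forall n x t, q n (H n (x, t)) = q n x) : smap (sprod dcyl (std 1)) dcyl :=
  @SMap (sprod dcyl (std 1)) dcyl (fun n p =>
    exist _ ((sval p.1).1, omap (fun x => H n (x, p.2)) (sval p.1).2) _) _.
Next Obligation.
move=> H qH n [[[[y t] [x|]] /= v] u] //=.
by rewrite /dcyl_valid /= qH.
Qed.
Next Obligation.
move=> H qH m n f [[[[y t] o] /= v] u]; apply: eq_exist.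
rewrite /dcyl_act /=; congr (_, _); case: ifP => //= _.
by case: o v => //= x _; rewrite -smap_act.
Qed.

End DoubleCylinder.

Section DoubleCylinderProj.
Variables (X Y : sset) (q : smap X Y).

Definition dcyl_lift (u : smap X X) (qu : vertical q u) : smap (dcyl q) (dcyl q).
Proof.
exists (fun n p => dcyl_fiber (q := q)
  (H := smap_comp u (@SMap (sprod X (std 1)) X (fun n p => p.1) (fun _ _ _ _ => erefl)))
  (fun n x _ => qu n x) n (const_at ord0 p)).
by move=> m n f p; rewrite -smap_act.
Defined.

(** Verticality is carried through the induction because the intermediate map of a transitivity step
    must be vertical to have a lift. *)
Lemma vhomotopic_dcyl (u v : smap X X) : vhomotopic q u v ->
  (vertical q u <-> vertical q v) /\
  forall (qu : vertical q u) (qv : vertical q v),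
    homotopic (dcyl_lift qu) (dcyl_lift qv).
Proof.
elim=> [{}u {}v [H qH HE]|{}u|{}u {}v _ [uv huv]|{}u w {}v _ [uw huw] _ [wv hwv]].
- split=> [|qu qv].
    have qu : vertical q u by move=> n x; have [<- _] := HE n x; exact: qH.
    have qv : vertical q v by move=> n x; have [_ <-] := HE n x; exact: qH.
    by [].
  apply: homotopicW; exists (dcyl_fiber qH) => n [[[y t] o] h].
  by split; apply: eq_exist; case: o h => //= x _; congr (_, Some _);
    case: (HE n x).
- split=> // qu qv; rewrite (Prop_irrelevance qu qv); exact: homotopic_refl.
- by split=> [|qv qu]; [split; apply uv|apply/homotopic_sym/huv].
- split=> [|qu qv]; first by rewrite uw.
  by have qw := proj1 uw qu; exact: homotopic_trans (huw qu qw) (hwv qw qv).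
Qed.

Definition simp_min n (t u : simp n 1) : simp n 1.
Proof.
exists (fun i => if t i == ord0 then ord0 else u i) => i j ij.
case: eqP => // ti; case: eqP => [tj|_]; last exact: simp_homo.
case: ti; apply/val_inj/eqP; rewrite -leqn0 /=.
by apply: leq_trans (simp_homo t ij) _; rewrite tj.
Defined.

Program Definition dcyl_section (s : smap Y X) (qs : forall n y, q n (s n y) = y) :
    smap (sprod Y (std 1)) (dcyl q) :=
  @SMap (sprod Y (std 1)) (dcyl q)
    (fun n p => exist _ (p.1, p.2, if simp_cst p.2 then None else Some (s n p.1)) _) _.
Next Obligation.
by move=> s qs n [y t]; rewrite /dcyl_valid /=; case: ifP => //= ->.
Qed.
Next Obligation.
move=> s qs m n f [y t]; apply: eq_exist; rewrite /dcyl_act /=; congr (_, _).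
case: (boolP (simp_cst t)) => [c|_] /=; last by rewrite smap_act.
by rewrite simp_cst_const.
Qed.

(** A homotopy over [Y] joins the identity of the cylinder to the lift of [s] after [q]. That lift
    factors through [dcyl_section], where taking the minimum with the parameter pushes the cylinder
    coordinate to the end 0. *)
Lemma dcyl_proj_hequiv : shrinkable q -> hequiv (dcyl_proj q).
Proof.
case=> s qs sq; exists (dcyl_end q ord0); last first.
  rewrite (_ : smap_comp _ _ = smap_id Y); last exact: smapP.
  exact: homotopic_refl.
have q_id : vertical q (smap_id X) by [].
have q_sq : vertical q (smap_comp s q) by move=> n x; exact: qs.
have [_ /(_ q_sq q_id) h] := vhomotopic_dcyl sq.
rewrite (_ : dcyl_lift q_id = smap_id _) in h; last first.
  by apply: smapP => n [[[y t] [x|]] v]; apply: eq_exist.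
apply: homotopic_trans h; apply: homotopicW.
unshelve eexists (@SMap (sprod (dcyl q) (std 1)) (dcyl q) (fun n p =>
   dcyl_section qs n ((sval p.1).1.1, simp_min p.2 (sval p.1).1.2)) _).
  by move=> m n f [p t]; rewrite -smap_act; congr (dcyl_section _ _ (_, _)).
move=> n [[[y t] o] v]; split; apply: eq_exist => /=.
  by rewrite /simp_cst /=; congr (_, _, _); apply: simpP.
have -> : simp_min (simp_const n ord_max) t = t by exact: simpP.
congr (_, _); case: o v => [x [/negPf /= -> ->]|/= ->] //.
Qed.

End DoubleCylinderProj.

Program Definition dcyl_diagram (J : cat) (X Y : diagram J) (f : nat_tr X Y) :
    diagram J :=
  @Diagram J (fun j => dcyl (f j))
    (fun i j g => @SMap (dcyl (f i)) (dcyl (f j)) (fun n p =>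
      exist _ (dmap Y g n (sval p).1.1, (sval p).1.2, omap (dmap X g n) (sval p).2) _) _)
    _ _.
Next Obligation.
move=> J X Y f i j g n [[[y t] [x|]] /= v] //=.
by case: v => tc /= <-; rewrite /dcyl_valid /= nt_nat.
Qed.
Next Obligation.
move=> J X Y f i j g m n h [[[y t] o] v]; apply: eq_exist; rewrite /dcyl_act /=.
rewrite smap_act; congr (_, _); case: ifP => //= _.
by case: o {v} => //= x; rewrite smap_act.
Qed.
Next Obligation.
move=> J X Y f i n [[[y t] o] v]; apply: eq_exist; rewrite /= dmap1.
by case: o {v} => //= x; rewrite dmap1.
Qed.
Next Obligation.
move=> J X Y f i j k h g n [[[y t] o] v]; apply: eq_exist; rewrite /= dmapM.
by case: o {v} => //= x; rewrite dmapM.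
Qed.

(** * Mapping spaces into an injectively fibrant diagram *)

Program Definition dprod_map (J : cat) (X Y : diagram J) (K L : sset)
    (f : nat_tr X Y) (g : smap K L) : nat_tr (dprod X K) (dprod Y L) :=
  @NatTr J (dprod X K) (dprod Y L)
    (fun j => @SMap (dprod X K j) (dprod Y L j) (fun n p => (f j n p.1, g n p.2)) _) _.
Next Obligation. by move=> *; congr (_, _); exact: smap_act. Qed.
Next Obligation. by move=> *; congr (_, _); exact: nt_nat. Qed.

Definition nt_id (J : cat) (X : diagram J) : nat_tr X X :=
  @NatTr J X X (fun j => smap_id (X j)) (fun _ _ _ _ _ => erefl).

Section Curry.
Variables (J : cat) (X P : diagram J) (A : sset).

Program Definition curry (f : nat_tr (dprod X A) P) : smap A (Map X P) :=
  @SMap A (Map X P) (fun m a => @NatTr J (dprod X (std m)) P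
    (fun j => @SMap (dprod X (std m) j) (P j) (fun n p => f j n (p.1, act p.2 a)) _) _) _.
Next Obligation. by move=> f m a j k n g [x t]; rewrite -smap_act /= actM. Qed.
Next Obligation.
by move=> f m a i j g n [x t]; rewrite -nt_nat.
Qed.
Next Obligation. by move=> f m n g a; apply: nat_trP => j k [x t] /=; rewrite actM. Qed.

Lemma curry_homotopy (f g : nat_tr (dprod X A) P)
    (H : nat_tr (dprod (dprod X A) (std 1)) P) :
  (forall j n x, H j n (const_at ord0 x) = f j n x) ->
  (forall j n x, H j n (const_at ord_max x) = g j n x) ->
  homotopy (curry f) (curry g).
Proof.
move=> H0 H1.
unshelve eexists (@SMap (sprod A (std 1)) (Map X P) (fun m a =>
  @NatTr J (dprod X (std m)) P (fun j => @SMap (dprod X (std m) j) (P j)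
    (fun n p => H j n ((p.1, act p.2 a.1), simp_comp a.2 p.2)) _) _) _).
- move=> k n h [x t]; rewrite -smap_act /= actM.
  by congr (H j _ (_, _)); apply: simpP.
- by move=> i j h n [x t]; rewrite -nt_nat.
- move=> m n h [a t]; apply: nat_trP => j k [x u] /=; rewrite actM.
  by congr (H j _ (_, _)); apply: simpP.
move=> n a; split; apply: nat_trP => j k [x t] /=.
  by rewrite -H0; congr (H j _ (_, _)); apply: simpP.
by rewrite -H1; congr (H j _ (_, _)); apply: simpP.
Qed.

End Curry.

Program Definition ev (J : cat) (X P : diagram J) : nat_tr (dprod X (Map X P)) P :=
  @NatTr J (dprod X (Map X P)) P (fun j =>
    @SMap (dprod X (Map X P) j) (P j)
      (fun n (p : X j n * nat_tr (dprod X (std n)) P) => p.2 j n (p.1, simp_id n)) _) _.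
Next Obligation.
move=> J X P j m n f [x h] /=; rewrite -smap_act /=.
by congr (h j _ (_, _)); apply: simpP.
Qed.
Next Obligation.
move=> J X P i j f n [x h]; exact: (nt_nat h f (x, simp_id n)).
Qed.

Lemma curry_ev (J : cat) (X P : diagram J) : curry (ev X P) = smap_id (Map X P).
Proof.
apply: smapP => n h; apply: nat_trP => j m [x t] /=.
by congr (h j _ (_, _)); apply: simpP.
Qed.

(** Factoring the universal map [ev X P] through [q] extends all maps from [X] to [P] at once, which
    gives the inverse [curry b]. The same factorization for a double cylinder shows that extensions
    are unique up to homotopy, which gives the other composite. *)
Theorem Map_pre_hequiv (J : cat) (X Y P : diagram J) (q : nat_tr X Y) :
  inj_fibrant P -> (forall j, shrinkable (q j)) -> hequiv (Map_pre P q).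
Proof.
move=> fP hq.
have shr A j : shrinkable (dprod_map q (smap_id A) j).
  have -> : dprod_map q (smap_id A) j = sprod_map A (q j) :> smap (sprod _ _) _.
    exact: smapP.
  exact: shrinkable_sprod.
have [b [h [h0 h1]]] :=
  factor_up_to_homotopy (r := dprod_map q (smap_id (Map X P))) (ev X P) fP
    (fun j => shrinkable_hequiv (shr _ j)).
exists (curry b); last first.
  apply: homotopic_sym; rewrite -curry_ev.
  rewrite (_ : smap_comp _ _ = curry (nat_comp b (dprod_map q (smap_id _)))).
    by apply: homotopicW; apply: (curry_homotopy (H := h)).
  by apply: smapP => n f; apply: nat_trP.
(* The maps to compare are [ev Y P] and [b'], both extending the same map up to homotopy: [h'] joins
   their restrictions along [qA]. *)
pose A := Map Y P; pose qA := dprod_map q (smap_id A).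
pose b' := nat_comp b (dprod_map (nt_id Y) (Map_pre P q)).
pose h' := nat_comp h (dprod_map (dprod_map (nt_id X) (Map_pre P q)) (smap_id (std 1))).
pose b01 (e : 'I_2) := if e == ord0 then ev Y P else b'.
have hb j e n x : h' j n (const_at e x) = b01 e j n (qA j n x).
  have [->|->] : e = ord0 \/ e = ord_max.
    by case: e => -[|[|//]] ?; [left|right]; apply: val_inj.
  - by rewrite /b01 eqxx; exact: h0.
  - exact: h1.
unshelve epose (c := @NatTr J (dcyl_diagram qA) P
  (fun j => @dcyl_rec _ _ (qA j) _ (fun e => b01 e j) (h' j) (hb j)) _).
  move=> i j f n [[[y t] [x|]] v] /=.
    exact: (nt_nat h' f (x, t)).
  exact: (nt_nat (b01 _) f y).
pose r := @NatTr J (dcyl_diagram qA) (dprod Y A) (fun j => dcyl_proj (qA j))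
  (fun _ _ _ _ _ => erefl).
(* The projection is the identity on both ends of the cylinder, so each end of [c] becomes homotopic
   to the single map [d]. *)
have [d [k [k0 k1]]] := factor_up_to_homotopy (r := r) c fP
  (fun j => dcyl_proj_hequiv (shr _ j)).
have side e : homotopic (curry (b01 e)) (curry d).
  unshelve epose (ke := @NatTr J (dprod (dprod Y A) (std 1)) P (fun j =>
    @SMap (dprod (dprod Y A) (std 1) j) (P j)
      (fun n p => k j n (dcyl_end (qA j) e n p.1, p.2)) _) _).
  - by move=> m n f [y t]; rewrite -smap_act; congr (k j _ (_, _)); exact: smap_act.
  - move=> i j f n [y t]; rewrite -nt_nat; congr (k j _ (_, _)).
    exact: eq_exist.
  apply/homotopicW/(curry_homotopy (H := ke)) => j n x /=.
    exact: k0.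
  exact: k1.
rewrite -curry_ev (_ : smap_comp _ _ = curry b'); last first.
  by apply: smapP => n f; apply: nat_trP => j m [y t];
  congr (b j m (_, _)); exact/esym/(smap_act (Map_pre P q)).
exact: homotopic_trans (side ord_max) (homotopic_sym (side ord0)).
Qed.

(** * Homotopy colimits and the homotopy limit of mapping spaces *)

(* The homotopy colimit of X as a bar construction: over c, an n-simplex is a chain
   j_n -> ... -> j_0 in J and an n-simplex of X_(j_n)(c). *)
Record hocolim_simplex (J C : cat) (X : psh_diagram J C) (c : C) (n : nat) :=
  HocolimSimplex {
    hs_chain : functor (ordc n) (opc J);
    hs_val : X (hs_chain ord_max) c n }.

Lemma eq_hocolim_simplex (J C : cat) (X : psh_diagram J C) (c : C) n
    (o : ordc n -> opc J) m m' e e' d d' (x x' : X (o ord_max) c n) :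
  m = m' -> x = x' ->
  @HocolimSimplex J C X c n (@Functor (ordc n) (opc J) o m e d) x =
  @HocolimSimplex J C X c n (@Functor (ordc n) (opc J) o m' e' d') x'.
Proof.
move=> E <-; case: _ / E e' d' => e' d'.
by rewrite (Prop_irrelevance e e') (Prop_irrelevance d d').
Qed.

Program Definition hocolim_at (J C : cat) (X : psh_diagram J C) (c : C) : sset :=
  @SSet (hocolim_simplex X c)
    (fun m n f s => @HocolimSimplex J C X c m
       (fcomp (hs_chain s) (simp_functor f))
       (pd_map X (@fmap _ _ (hs_chain s) (f ord_max) ord_max (leq_ord _)) c m
          (act f (hs_val s)))) _ _.
Next Obligation.
move=> J C X c n [[o m e d] x]; apply: eq_hocolim_simplex => /=.
  do 3 apply: functional_extensionality_dep => ?.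
  by congr (m _ _); apply: bool_irrelevance.
rewrite act1 -[RHS](pd_map1 (p := X)).
exact: (congr1 (fun h => pd_map X h c n x) (fmap_refl (Functor e d) _)).
Qed.
Next Obligation.
move=> J C X c l m n f g [[o h e d] x]; apply: eq_hocolim_simplex => /=.
  do 3 apply: functional_extensionality_dep => ?.
  by congr (h _ _); apply: bool_irrelevance.
rewrite -smap_act actM -(pd_mapM (p := X)).
apply: (congr1 (fun h => pd_map X h c l (act f (act g x)))).
exact/esym/(fmap_trans (Functor e d)).
Qed.

Program Definition hocolim (J C : cat) (X : psh_diagram J C) : spsh C :=
  @Diagram (opc C) (hocolim_at X)
    (fun c d f => @SMap (hocolim_at X c) (hocolim_at X d) (fun n s =>
       @HocolimSimplex J C X d n (hs_chain s) (dmap (X _) f n (hs_val s))) _) _ _.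
Next Obligation.
move=> J C X c d f m n g [s x]; congr HocolimSimplex.
by rewrite /= -smap_act nt_nat.
Qed.
Next Obligation. by move=> J C X c n [s x]; rewrite /= dmap1. Qed.
Next Obligation. by move=> J C X c d e g f n [s x]; rewrite /= dmapM. Qed.

Program Definition hocolim_desc (J C : cat) (X : psh_diagram J C) (Y : spsh C)
    (a : cocone X Y) : nat_tr (hocolim X) Y :=
  @NatTr (opc C) (hocolim X) Y (fun c => @SMap (hocolim X c) (Y c)
    (fun n s => a (hs_chain s ord_max) c n (hs_val s)) _) _.
Next Obligation. by move=> J C X Y a c m n f s; rewrite /= cocone_nat smap_act. Qed.
Next Obligation. by move=> J C X Y a c d f n s; rewrite /= nt_nat. Qed.

Section HolimMap.
Variables (J C : cat) (X : psh_diagram J C) (P : spsh C).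

(** The structure map of [hocolim X] as the coend of the [X j] with the nerves of the slices of
    [opc J]. In [J] the map [ss_map s] goes from [j] to the last vertex, so [x] is pushed
    forward. *)
Definition slice_val (j : J) c n (s : @slice_simplex (opc J) j n) (x : X j c n) :
    hocolim X c n :=
  @HocolimSimplex J C X c n (ss_chain s) (pd_map X (ss_map s) c n x).

Lemma slice_val_act j c m n (f : simp m n) (s : @slice_nerve (opc J) j n) (x : X j c n) :
  act f (slice_val s x) = slice_val (act f s) (act f x).
Proof.
congr HocolimSimplex; rewrite /= -smap_act -(pd_mapM (p := X)).
by [].
Qed.

Program Definition holim_of_Map : smap (Map (hocolim X) P) (holim (Map_diagram X P)) :=
  @SMap (Map (hocolim X) P) (holim (Map_diagram X P)) (fun m a =>
    @NatTr (opc J) (dprod (slice_nerves (opc J)) (std m)) (Map_diagram X P)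
      (fun j => @SMap (sprod (@slice_nerve (opc J) j) (std m)) (Map (X j) P)
        (fun n p => @NatTr (opc C) (dprod (X j) (std n)) P
          (fun c => @SMap (sprod (X j c) (std n)) (P c)
            (fun l q => a c l (slice_val (act q.2 p.1) q.1, simp_comp p.2 q.2)) _)
          _) _) _) _.
Next Obligation.
move=> m a j n [s t] c k l f [x u]; rewrite -smap_act; congr (a c k (_, _)).
by rewrite [RHS]slice_val_act -actM.
Qed.
Next Obligation.
move=> m a j n [s t] c d f l [x u].
apply: etrans (nt_nat a f (slice_val (act u s) x, simp_comp t u)).
by congr (a d l (_, _)); congr HocolimSimplex; exact: nt_nat.
Qed.
Next Obligation.
move=> m a j k n f [s t]; apply: nat_trP => c l [x u].
by congr (a c l (slice_val _ _, _)); symmetry; apply: (@actM (slice_nerve _)).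
Qed.
Next Obligation.
move=> m a i j f n [s t]; apply: nat_trP => c l [x u].
congr (a c l (_, _)); congr HocolimSimplex; rewrite /= -(pd_mapM (p := X)).
by rewrite /= compA.
Qed.
Next Obligation.
move=> m n f a; apply: nat_trP => j k [s t]; apply: nat_trP => c l [x u].
by congr (a c l (_, _)); apply: simpP.
Qed.

(** With it every simplex of the coend gets a canonical representative, from which the inverse of
    [holim_of_Map] reads off its values. *)
Definition last_slice n (s : functor (ordc n) (opc J)) :
    @slice_nerve (opc J) (s ord_max) n :=
  @SliceSimplex (opc J) (s ord_max) n s (idm (s ord_max)).

Lemma last_slice_val c n (s : hocolim X c n) :
  slice_val (last_slice (hs_chain s)) (hs_val s) = s.
Proof. by case: s => s x; congr HocolimSimplex; rewrite /= pd_map1. Qed.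

Section Inverse.
Variables (m : nat) (b : holim (Map_diagram X P) m).

Definition holim_value j n (p : sprod (@slice_nerve (opc J) j) (std m) n) :
  nat_tr (dprod (X j) (std n)) P := nt b j n p.

Lemma holim_value_slice i j (f : @hom (opc J) i j) n (s : @slice_nerve (opc J) i n)
    t c l x u :
  holim_value (dmap (slice_nerves (opc J)) f n s, t) c l (x, u) =
  holim_value (s, t) c l (pd_map X f c l x, u).
Proof.
exact: (congr1 (fun h : nat_tr (dprod (X j) (std n)) P => h c l (x, u))
  (nt_nat b f (s, t))).
Qed.

Lemma holim_value_act j k n (f : simp k n) (s : @slice_nerve (opc J) j n) t c l x u :
  @holim_value j k (act f s, simp_comp t f) c l (x, u) =
  holim_value (s, t) c l (x, simp_comp f u).
Proof.
exact: (congr1 (fun h : nat_tr (dprod (X j) (std k)) P => h c l (x, u))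
  (smap_act (nt b j) f (s, t))).
Qed.

Program Definition Map_of_holim_at : Map (hocolim X) P m :=
  @NatTr (opc C) (dprod (hocolim X) (std m)) P
    (fun c => @SMap (sprod (hocolim X c) (std m)) (P c) (fun l p =>
      holim_value (last_slice (hs_chain p.1), p.2) c l (hs_val p.1, simp_id l)) _) _.
Next Obligation.
(* The operator [f] may change the last vertex of the chain; naturality in [j] shifts this change
   from the value [x] to the slice. *)
move=> c k l f [[s x] t] /=; rewrite -holim_value_slice.
have -> : dmap (slice_nerves (opc J)) (@fmap _ _ s (f ord_max) ord_max (leq_ord _)) k
    (last_slice (fcomp s (simp_functor f))) = act f (last_slice s).
  by congr SliceSimplex; rewrite /= compm1 comp1m.
rewrite holim_value_act -smap_act.
by rewrite (_ : simp_comp f _ = simp_comp (simp_id l) f) //; apply: simpP.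
Qed.
Next Obligation.
move=> c d f l [[s x] t].
exact: (nt_nat (holim_value (last_slice s, t)) f (x, simp_id l)).
Qed.

End Inverse.

Program Definition Map_of_holim : smap (holim (Map_diagram X P)) (Map (hocolim X) P) :=
  @SMap (holim (Map_diagram X P)) (Map (hocolim X) P) Map_of_holim_at _.
Next Obligation.
by move=> m n f b; apply: nat_trP => c l [z t].
Qed.

Lemma holim_of_MapK n : cancel (holim_of_Map n) (Map_of_holim n).
Proof.
move=> a; apply: nat_trP => c l [z t].
transitivity (nt a c l (slice_val (act (simp_id l) (last_slice (hs_chain z)))
    (hs_val z), simp_comp t (simp_id l))); first by [].
by rewrite act1 last_slice_val simp_compm1.
Qed.

Lemma Map_of_holimK n : cancel (Map_of_holim n) (holim_of_Map n).
Proof.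
move=> b; apply: nat_trP => j k [s t]; apply: nat_trP => c l [x u] /=.
rewrite -holim_value_slice.
rewrite [dmap _ _ _ _](_ : _ = act u s); last first.
  by congr SliceSimplex; rewrite /= comp1m.
by rewrite holim_value_act simp_compm1.
Qed.

End HolimMap.

Lemma to_holim_Map_cone (J C : cat) (X : psh_diagram J C) (Y P : spsh C)
    (a : cocone X Y) :
  to_holim (Map_cone a P) =
  smap_comp (holim_of_Map X P) (Map_pre P (hocolim_desc a)).
Proof.
apply: smapP => m h; apply: nat_trP => j n [s t]; apply: nat_trP => c l [x u] /=.
by rewrite cocone_nat.
Qed.

(* Map(-, P) turns homotopy colimits into homotopy limits. *)
Theorem is_colimit_in_shrinkable (J C : cat) (D : spsh C -> Prop)
    (X : psh_diagram J C) (Y : spsh C) (a : cocone X Y) :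
  (forall P, D P -> inj_fibrant P) -> (forall c, shrinkable (hocolim_desc a c)) ->
  is_colimit_in D X Y a.
Proof.
move=> fD ha P /fD fP; rewrite to_holim_Map_cone; apply: weq_comp.
  exact/hequiv_weq/Map_pre_hequiv.
exact: iso_weq (@holim_of_MapK _ _ X P) (@Map_of_holimK _ _ X P).
Qed.

(** * Contraction of the bar construction over a whole category *)

Definition idf (C : cat) : functor C C :=
  @Functor C C id (fun _ _ f => f) (fun _ => erefl) (fun _ _ _ _ _ => erefl).

Definition const_chain (C : cat) (n : nat) (a : C) : functor (ordc n) C :=
  @Functor (ordc n) C (fun=> a) (fun _ _ _ => idm a) (fun=> erefl)
    (fun _ _ _ _ _ => esym (compm1 (idm a))).

(* The contraction of the chains under T to the constant chain at T, as an explicit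
   homotopy with parameter t: the vertices at which t vanishes are replaced by T. *)
Section Switch.
Variables (C : cat) (T : C).

Definition sw (b : bool) (a : C) : C := if b then T else a.

Definition sw_out b a (g : hom T a) : hom (sw b a) a :=
  if b return hom (sw b a) a then g else idm a.

Definition sw_in b a (g : hom T a) : hom T (sw b a) :=
  if b return hom T (sw b a) then idm T else g.

Definition sw_map (b b' : bool) (a a' : C) : b' ==> b -> hom T a' -> hom a a' ->
    hom (sw b a) (sw b' a') :=
  match b, b' return b' ==> b -> hom T a' -> hom a a' -> hom (sw b a) (sw b' a') with
  | true, true => fun _ _ _ => idm T
  | true, false => fun _ g _ => g
  | false, true => fun h _ _ => False_rect _ (notF h)
  | false, false => fun _ _ k => k
  end.

Lemma sw_map1 b a h (g : hom T a) : @sw_map b b a a h g (idm a) = idm _.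
Proof. by case: b h. Qed.

Lemma sw_mapM b b' b'' a a' a'' h h' h'' (g' : hom T a') (g'' : hom T a'')
    (k : hom a a') (k' : hom a' a'') : k' oc g' = g'' ->
  @sw_map b b'' a a'' h'' g'' (k' oc k) =
  @sw_map b' b'' a' a'' h' g'' k' oc @sw_map b b' a a' h g' k.
Proof.
by case: b b' b'' h h' h'' => -[] [] //= _ _ _; rewrite ?compm1 ?comp1m // => ->.
Qed.

Lemma sw_map_in b b' a a' h (g : hom T a) (g' : hom T a') (k : hom a a') :
  k oc g = g' -> @sw_map b b' a a' h g' k oc sw_in b g = sw_in b' g'.
Proof. by case: b b' h => -[] //= _; rewrite ?comp1m ?compm1. Qed.

Lemma sw_out_map b b' a a' h (g : hom T a) (g' : hom T a') (k : hom a a') :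
  k oc g = g' -> sw_out b' g' oc @sw_map b b' a a' h g' k = k oc sw_out b g.
Proof. by case: b b' h => -[] //= _; rewrite ?comp1m ?compm1. Qed.

Lemma sw_out_in b a (g : hom T a) : sw_out b g oc sw_in b g = g.
Proof. by case: b; rewrite /= ?comp1m ?compm1. Qed.

Definition under n (S : functor (ordc n) C) (g : hom T (S ord0)) (i : 'I_n.+1) :
    hom T (S i) :=
  @fmap _ _ S ord0 i (leq0n i) oc g.

Variables (n : nat) (S : functor (ordc n) C) (g : hom T (S ord0)) (t : simp n 1).

Lemma under_map (i j : 'I_n.+1) (ij : (i <= j)%N) :
  @fmap _ _ S i j ij oc under g i = under g j.
Proof. by rewrite /under compA (@fmap_trans _ _ S ord0 i j _ _ (leq0n j)). Qed.

Lemma under_act m (f : simp m n) (i : 'I_m.+1) :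
  @under m (fcomp S (simp_functor f)) (under g (f ord0)) i = under g (f i).
Proof. exact: under_map. Qed.

Lemma simp_vanish (i j : 'I_n.+1) : (i <= j)%N -> (t j == ord0) ==> (t i == ord0).
Proof.
move=> ij; apply/implyP => /eqP tj; apply/eqP/val_inj/eqP; rewrite -leqn0 /=.
by apply: leq_trans (simp_homo t ij) _; rewrite tj.
Qed.

Program Definition switch : functor (ordc n) C :=
  @Functor (ordc n) C (fun i => sw (t i == ord0) (S i))
    (fun i j ij => sw_map (simp_vanish ij) (under g j) (@fmap _ _ S i j ij)) _ _.
Next Obligation.  by move=> i /=; rewrite (@fmap_refl _ _ S i) sw_map1. Qed.
Next Obligation.
move=> i j k jk ij /=; rewrite -(@fmap_trans _ _ S i j k ij jk).
apply: sw_mapM; exact: under_map.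
Qed.

End Switch.

Section LanContraction.
Variables (C : cat) (F : spsh C).

Definition lan_id : spsh C := lan (idf C) F.

Definition lan_unit (T : C) n (x : F T n) : lan_id T n :=
  @LanSimplex C C (idf C) F T n (const_chain n T) (idm T) x.

Definition lan_val (T : C) n (s : lan_id T n) : F T n :=
  dmap F (under (ls_map s) ord_max) n (ls_val s).

Definition lan_switch (T : C) n (s : lan_id T n) (t : simp n 1) : lan_id T n :=
  @LanSimplex C C (idf C) F T n (switch (ls_map s) t)
    (sw_in (t ord0 == ord0) (ls_map s))
    (dmap F (sw_out (t ord_max == ord0) (under (ls_map s) ord_max)) n (ls_val s)).

Lemma lan_unit_act T m n (f : simp m n) (x : F T n) :
  act f (lan_unit x) = lan_unit (act f x).
Proof. by apply: eq_lan_simplex => //=; rewrite ?compm1 ?dmap1. Qed.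

Lemma lan_val_unit T n (x : F T n) : lan_val (lan_unit x) = x.
Proof. 
rewrite -[RHS](dmap1 F); exact: (congr1 (fun h => @dmap _ F T T h n x) (compm1 _)).
Qed.

Lemma lan_switch_act T m n (f : simp m n) (s : lan_id T n) (t : simp n 1) :
  act f (lan_switch s t) = lan_switch (act f s) (simp_comp t f).
Proof.
case: s => S g x; apply: eq_lan_simplex => /=.
- apply: functional_extensionality_dep => i; apply: functional_extensionality_dep => j.
  apply: funext => ij; rewrite (under_act g f j).
  by congr (sw_map _ _ _); apply: bool_irrelevance.
- exact: sw_map_in.
- rewrite -smap_act -!(dmapM F).
  apply: (congr1 (fun h => @dmap _ F _ _ h m (act f x))) => /=.
  rewrite (sw_out_map _ (@under_map _ _ _ S g (f ord_max) ord_max (leq_ord _))).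
  by rewrite (under_act g f ord_max).
Qed.

Lemma lan_switch1 T n (s : lan_id T n) : lan_switch s (simp_const n ord_max) = s.
Proof. by case: s => -[o m e c] g x; apply: eq_lan_simplex; rewrite //= dmap1. Qed.

Lemma lan_switch0 T n (s : lan_id T n) :
  lan_switch s (simp_const n ord0) = lan_unit (lan_val s).
Proof. by case: s => -[o m e c] g x; apply: eq_lan_simplex. Qed.

(** The map from [T] to the old last vertex factors through the new one, so the contraction stays in
    the fibres over [F T]. *)
Lemma lan_val_switch T n (s : lan_id T n) t : lan_val (lan_switch s t) = lan_val s.
Proof.
rewrite /lan_val /= -(dmapM F) /=.
apply: (congr1 (fun h => @dmap _ F _ _ h n (ls_val s))).
rewrite -[RHS](sw_out_in (t ord_max == ord0)); congr (_ oc _).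
exact: sw_map_in.
Qed.

End LanContraction.

(** * Chains of indices, and the contraction of the fibres of the counit *)

Definition pchain n (o : 'I_n.+1 -> nat_pos)
    (h : forall i j : 'I_n.+1, (i <= j)%N -> (fs_ob (o j) <= fs_ob (o i))%N) :
    functor (ordc n) (opc nat_pos) :=
  @Functor (ordc n) (opc nat_pos) o h
    (fun _ => bool_irrelevance _ _) (fun _ _ _ _ _ => bool_irrelevance _ _).

Lemma pchain_homo n (c : functor (ordc n) (opc nat_pos)) (i j : 'I_n.+1) :
  (i <= j)%N -> (fs_ob (c j) <= fs_ob (c i))%N.
Proof. exact: (@fmap _ _ c i j). Qed.

Lemma nat_posP (a b : nat_pos) : fs_ob a = fs_ob b -> a = b.
Proof.
by case: a b => a ha [b hb] /= E; subst b; congr FullSub; apply: bool_irrelevance.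
Qed.

Lemma pchainP n (c c' : functor (ordc n) (opc nat_pos)) :
  (forall i, fs_ob (c i) = fs_ob (c' i)) -> c = c'.
Proof.
case: c c' => o m e d [o' m' e' d'] /= E.
have {}E : o = o' by apply: funext => i; apply: nat_posP.
subst o'; apply: eq_functor; do 3 apply: functional_extensionality_dep => ?.
exact: bool_irrelevance.
Qed.

Program Definition pmax (k : nat_pos) n (c : functor (ordc n) (opc nat_pos)) :
    functor (ordc n) (opc nat_pos) :=
  @pchain n (fun i => @FullSub natc _ (maxn (fs_ob k) (fs_ob (c i))) _) _.
Next Obligation. by move=> k n c i; rewrite /= leq_max (fs_prop k). Qed.
Next Obligation.
by move=> k n c i j ij; rewrite /= geq_max leq_maxl leq_max pchain_homo ?orbT.
Qed.

(** Indices decrease along a chain, so the larger chain has to occupy the initial segment on which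
    [t] vanishes. *)
Definition pswitch n (c c' : functor (ordc n) (opc nat_pos))
    (cc' : forall i, (fs_ob (c' i) <= fs_ob (c i))%N) (t : simp n 1) :
  functor (ordc n) (opc nat_pos).
Proof.
apply: (@pchain n (fun i => if t i == ord0 then c i else c' i)) => i j ij /=.
have := simp_vanish t ij; case: (t i == ord0) (t j == ord0) => -[] //= _.
- exact: pchain_homo.
- exact: leq_trans (cc' j) (pchain_homo c ij).
- exact: pchain_homo.
Defined.

Section CounitFiber.
Variables (O : spsh OmegaC) (T : OmegaC).

Let H : sset := hocolim (filtration O) T.
Let q : smap H (O T) := hocolim_desc (counits O) T.

(* A simplex of the homotopy colimit is determined by its chain of indices c and by
   the underlying simplex s of the bar construction over all closed trees; the pairs
   that occur are those with [in_filtration c s]. *)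
Definition hs_lan n (z : H n) : lan_id O T n :=
  @LanSimplex OmegaC OmegaC (idf OmegaC) O T n
    (fcomp (incl _) (ls_chain (hs_val z))) (ls_map (hs_val z)) (ls_val (hs_val z)).

Lemma hs_lan_act m n (f : simp m n) (z : H n) : hs_lan (act f z) = act f (hs_lan z).
Proof. by case: z => c [[o h e d] g x]; apply: eq_lan_simplex. Qed.

Lemma hs_switch_act m n (f : simp m n) (z : H n) (t : simp n 1) :
  lan_switch (hs_lan (act f z)) (simp_comp t f) = act f (lan_switch (hs_lan z) t).
Proof. by rewrite hs_lan_act lan_switch_act. Qed.

Definition in_filtration n (c : functor (ordc n) (opc nat_pos)) (s : lan_id O T n) :
    Prop :=
  forall i, dendroidal (fs_ob (c ord_max)) (ls_chain s i).

Definition hs_mk n (c : functor (ordc n) (opc nat_pos)) (s : lan_id O T n)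
    (h : in_filtration c s) : H n :=
  @HocolimSimplex _ _ (filtration O) T n c
    (@LanSimplex _ _ (incl (fs_ob (c ord_max))) (restrict _ O) T n
      (@Functor (ordc n) (OmegaC_le _) (fun i => FullSub (h i))
        (fun i j ij => @fmap _ _ (ls_chain s) i j ij)
        (fmap1 (ls_chain s)) (fun i j k => @fmapM _ _ (ls_chain s) i j k))
      (ls_map s) (ls_val s)).

Lemma hs_in_filtration n (z : H n) : in_filtration (hs_chain z) (hs_lan z).
Proof. by move=> i; exact: (fs_prop (ls_chain (hs_val z) i)). Qed.

Lemma hs_mkE n (z : H n) : hs_mk (@hs_in_filtration n z) = z.
Proof.
by case: z => c [[o m e d] g x]; congr HocolimSimplex; apply: eq_lan_simplex_fullsub.
Qed.

Lemma hs_lan_mk n c s (h : @in_filtration n c s) : hs_lan (hs_mk h) = s.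
Proof. by case: s h => -[o m e d] g x h; apply: eq_lan_simplex. Qed.

Lemma hocolim_filtrationP n (z z' : H n) :
  hs_chain z = hs_chain z' -> hs_lan z = hs_lan z' -> z = z'.
Proof.
(* In terms of [hs_mk] both equations can be substituted, and only proofs of a proposition remain to
   be compared. *)
suff mkE m c c' s s' (h : @in_filtration m c s) (h' : in_filtration c' s') :
    c = c' -> s = s' -> hs_mk h = hs_mk h'.
  by move=> E E'; rewrite -(hs_mkE z) -(hs_mkE z'); exact: mkE.
by move=> E E'; subst c' s'; rewrite (Prop_irrelevance h h').
Qed.

Lemma counit_hs_lan n (z : H n) : q n z = lan_val (hs_lan z).
Proof.
by rewrite /lan_val dmapM.
Qed.

Program Definition hs_homotopy
    (c : forall n, H n -> simp n 1 -> functor (ordc n) (opc nat_pos))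
    (s : forall n, H n -> simp n 1 -> lan_id O T n)
    (h : forall n z t, in_filtration (@c n z t) (@s n z t))
    (cA : forall m n (f : simp m n) z t i,
      fs_ob (c m (act f z) (simp_comp t f) i) = fs_ob (c n z t (f i)))
    (sA : forall m n (f : simp m n) z t,
      s m (act f z) (simp_comp t f) = act f (s n z t)) : smap (sprod H (std 1)) H :=
  @SMap (sprod H (std 1)) H (fun n p => hs_mk (h n p.1 p.2)) _.
Next Obligation.
move=> c s h cA sA m n f [z t]; apply: hocolim_filtrationP.
  by apply: pchainP => i; exact: (cA m n f z t i).
by apply: etrans (hs_lan_mk _) _; rewrite [RHS]hs_lan_act [in RHS]hs_lan_mk; exact: sA.
Qed.

Definition hs_end (K : smap (sprod H (std 1)) H) (e : 'I_2) : smap H H :=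
  @SMap H H (fun n z => K n (const_at e z)) (fun m n f z => smap_act K f (const_at e z)).

Lemma vhomotopic_ends (K : smap (sprod H (std 1)) H) :
  (forall n z t, lan_val (hs_lan (K n (z, t))) = lan_val (hs_lan z)) ->
  vhomotopic q (hs_end K ord0) (hs_end K ord_max).
Proof. by move=> qK; apply: rst_step; exists K => // n z t; rewrite !counit_hs_lan. Qed.

Lemma dendroidal_bound : exists k : nat_pos, dendroidal (fs_ob k) T.
Proof.
(* The successor makes the index positive. *)
exists (@FullSub natc _ (\max_(e : fs_ob T) #|inputs e|).+1 isT) => e /=.
by apply: leqW; exact: leq_bigmax.
Qed.

Lemma counit_shrinkable : shrinkable q.
Proof.
have [k Tk] := dendroidal_bound.
have Tmax n (c : functor (ordc n) (opc nat_pos)) i : dendroidal (fs_ob (pmax k c i)) T.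
  exact (dendroidal_le (leq_maxl _ _) Tk).
have max_ge n (c : functor (ordc n) (opc nat_pos)) i :
    (fs_ob (c i) <= fs_ob (pmax k c i))%N.
  exact: leq_maxr.
have max_gek n (c : functor (ordc n) (opc nat_pos)) i :
    (fs_ob (@const_chain (opc nat_pos) n k i) <= fs_ob (pmax k c i))%N.
  exact: leq_maxl.
(* The raised indices sit at parameter 0 and the original ones at parameter 1; a larger index only
   weakens the bound on the trees. *)
unshelve epose (raise := hs_homotopy (c := fun n z t => pswitch (max_ge n (hs_chain z)) t)
  (s := fun n z t => hs_lan z) _ _ _).
- move=> n z t i; refine (dendroidal_le _ (@hs_in_filtration n z i)) => /=.
  by case: ifP => // _; exact: leq_maxr.
- by move=> m n f z t i /=; case: ifP.
- by move=> m n f z t; exact: hs_lan_act.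
(* All indices are now at least [k], so [T] itself may enter the chain of trees. *)
unshelve epose (contract := hs_homotopy (c := fun n z t => pmax k (hs_chain z))
  (s := fun n z t => lan_switch (hs_lan z) t) _ _ _).
- move=> n z t i /=; case: (t i == ord0) => /=; first exact: Tmax.
  exact (dendroidal_le (leq_maxr _ _) (@hs_in_filtration n z i)).
- by [].
- move=> m n f z t; exact: hs_switch_act.
(* All trees are now [T], for which the bound [k] suffices. *)
unshelve epose (lower := hs_homotopy (c := fun n z t => pswitch (max_gek n (hs_chain z)) t)
  (s := fun n z t => lan_unit (lan_val (hs_lan z))) _ _ _).
- by move=> n z t i /=; case: ifP => // _; exact: Tmax.
- by move=> m n f z t i /=; case: ifP.
- move=> m n f z t; apply: etrans (esym (lan_unit_act _ _)).
  by congr lan_unit; rewrite -!counit_hs_lan smap_act.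
unshelve epose (s := @SMap (O T) H (fun n y =>
  @hs_mk n (@const_chain (opc nat_pos) n k) (lan_unit y) (fun=> Tk)) _).
  move=> m n f y; apply: hocolim_filtrationP; first exact: pchainP.
  by rewrite hs_lan_act !hs_lan_mk lan_unit_act.
exists s => [n y|]; first by rewrite counit_hs_lan hs_lan_mk lan_val_unit.
have -> : smap_comp s q = hs_end lower ord_max.
  apply: smapP => n z; apply: hocolim_filtrationP; first exact: pchainP.
  by rewrite !hs_lan_mk counit_hs_lan.
(* The three homotopies form a zigzag from [s] after [q] to the identity: [lower] backwards, then
   [contract] and [raise] forwards. The next equalities match their ends. *)
have E32 : hs_end lower ord0 = hs_end contract ord0.
  apply: smapP => n z; apply: hocolim_filtrationP; first exact: pchainP.
  by rewrite !hs_lan_mk lan_switch0.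
have E21 : hs_end contract ord_max = hs_end raise ord0.
  apply: smapP => n z; apply: hocolim_filtrationP; first exact: pchainP.
  by rewrite !hs_lan_mk lan_switch1.
have E1 : hs_end raise ord_max = smap_id H.
  apply: smapP => n z; apply: hocolim_filtrationP; first exact: pchainP.
  by rewrite !hs_lan_mk.
have V1 : vhomotopic q (hs_end raise ord0) (smap_id H).
  by rewrite -E1; apply: vhomotopic_ends => n z t; rewrite hs_lan_mk.
have V2 : vhomotopic q (hs_end contract ord0) (hs_end contract ord_max).
  by apply: vhomotopic_ends => n z t; rewrite hs_lan_mk lan_val_switch.
have V3 : vhomotopic q (hs_end lower ord0) (hs_end lower ord_max).
  by apply: vhomotopic_ends => n z t; rewrite hs_lan_mk lan_val_unit.
apply: rst_trans (rst_sym _ _ _ _ V3) _; rewrite E32.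
by apply: rst_trans V2 _; rewrite E21.
Qed.

End CounitFiber.

Theorem corollary4p14 (O : spsh OmegaC) (hO : unital_operad O) :
  is_colimit_in unital_operad (filtration O) O (counits O).
Proof.
apply: is_colimit_in_shrinkable => [P []//|T]; exact: counit_shrinkable.
Qed.
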